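(* For every $n\in\mathbb{N}$, let $\mu_n$ denote the law, in the tracial $W^*$-probability space $(\mathcal{M},\mathrm{tr})$, of the selfadjoint element $$\frac{1}{\sqrt{n}}\sum_{i=1}^n\bigl(U(\gamma_i)-A_0\bigr)\in\mathcal{M}.$$ Then, when $n\to\infty$, the probability measures $\mu_n$ have a $\mathrm{weak}^*$-limit: there is a probability measure $\mu_{\underline{w}}$ on $\mathbb{R}$, which depends on the tuple of weights $\underline{w}=(w_1,\ldots,w_d)$, such that $\int_{\mathbb{R}} f\,d\mu_n\to\int_{\mathbb{R}} f\,d\mu_{\underline{w}}$ for every bounded continuous $f:\mathbb{R}\to\mathbb{R}$.
   Context: Fix an integer $d\ge 2$ and a tuple of weights $\underline{w}=(w_1,\ldots,w_d)$ with $w_1\ge w_2\ge\cdots\ge w_d>0$ and $w_1+\cdots+w_d=1$. For $n\in\mathbb{N}=\{1,2,\ldots\}$ put $\mathsf{p}_n:=w_1^n+\cdots+w_d^n$. $S_\infty$ is the group of finitely supported permutations of $\mathbb{N}$ (products are compositions, read right to left), with unit $e$; $\gamma_n:=(1,n+1)\in S_\infty$ for $n\in\mathbb{N}$. Define $\chi:S_\infty\to\mathbb{R}$ by $\chi(\sigma):=\prod_{V}\mathsf{p}_{|V|}$, the product over all orbits $V$ of $\sigma$ with $|V|\ge 2$ (an empty product is $1$). It is known that $\chi$ is a positive-definite class function (a character of $S_\infty$). GNS representation of $\chi$: $\mathcal{H}$ is a complex Hilbert space with a map $S_\infty\ni\sigma\mapsto\widehat{\sigma}\in\mathcal{H}$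 whose image has dense linear span, such that $\langle\widehat{\sigma},\widehat{\tau}\rangle=\chi(\sigma\tau^{-1})$ for all $\sigma,\tau\in S_\infty$. $U:S_\infty\to B(\mathcal{H})$ is the unitary representation determined by $U(\sigma)\widehat{\tau}=\widehat{\sigma\tau}$. $\mathcal{M}\subseteq B(\mathcal{H})$ is the closure in the weak operator topology (WOT) of the linear span of $\{U(\sigma):\sigma\in S_\infty\}$, a von Neumann algebra, and $\mathrm{tr}:\mathcal{M}\to\mathbb{C}$, $\mathrm{tr}(T)=\langle T\widehat{e},\widehat{e}\rangle$, is a faithful trace-state on $\mathcal{M}$. $A_0\in\mathcal{M}$ is the selfadjoint operator which is the (known to exist) limit in the strong operator topology of $\frac1n\sum_{i=1}^n U(\gamma_i)$ as $n\to\infty$. The law of a selfadjoint $T\in\mathcal{M}$ is the unique compactly supported probability measure $\mu$ on $\mathbb{R}$ with $\int t^k\,d\mu(t)=\mathrm{tr}(T^k)$ for all $k\ge 0$. *)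

(* Defs.v *)
From HB Require Import structures.
From mathcomp Require Import all_boot all_order all_algebra sesquilinear.
From mathcomp Require Import finmap complex.
From mathcomp Require Import all_classical all_reals all_analysis.

Set Implicit Arguments.
Unset Strict Implicit.
Unset Printing Implicit Defensive.

Import Order.TTheory GRing.Theory Num.Theory.
Import numFieldNormedType.Exports.

Local Open Scope classical_set_scope.
Local Open Scope complex_scope.
Local Open Scope ring_scope.

(* The group S_oo of finitely supported permutations of {1, 2, ...}; the point
   k + 1 of this set is encoded as [k : nat]. *)
Record Sinf := MkSinf {
  sfun :> nat -> nat;
  sinv : nat -> nat;
  sfunK : cancel sfun sinv;
  sinvK : cancel sinv sfun;
  sfin : finite_set [set k | sfun k <> k] }.

Lemma Sinf_eq (s t : Sinf) : sfun s = sfun t -> s = t.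
Proof.
case: s t => [f f' fK f'K Ff] [g g' gK g'K Fg] /= efg; subst g.
have ei : f' = g' by apply/funext => x; rewrite -{1}(g'K x) fK.
by subst g'; congr MkSinf; exact: Prop_irrelevance.
Qed.

HB.instance Definition _ := gen_eqMixin Sinf.
HB.instance Definition _ := gen_choiceMixin Sinf.

Section SinfGroup.

Fact sinf1_fin : finite_set [set k : nat | id k <> k].
Proof. by rewrite (_ : mkset _ = set0) //; apply/seteqP; split => k //=. Qed.

Definition sinf1 : Sinf :=
  @MkSinf id id (fun=> erefl) (fun=> erefl) sinf1_fin.

Fact sinfV_fin (s : Sinf) : finite_set [set k | sinv s k <> k].
Proof.
apply: sub_finite_set (sfin s) => k /= H E; apply: H.
by rewrite -{1}E sfunK.
Qed.

Definition sinfV (s : Sinf) : Sinf :=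
  @MkSinf (sinv s) s (@sinvK s) (@sfunK s) (sinfV_fin s).

Fact sinfM_fin (s t : Sinf) : finite_set [set k | (s \o t) k <> k].
Proof.
apply: (@sub_finite_set _ _ ([set k | s k <> k] `|` [set k | t k <> k])).
  move=> k /= H; case: (pselect (t k = k)) => [E|]; last by right.
  by left => E'; apply: H; rewrite /= E.
by rewrite finite_setU; split; exact: sfin.
Qed.

(* composition, read right to left *)
Definition sinfM (s t : Sinf) : Sinf :=
  @MkSinf (s \o t) (sinv t \o sinv s)
    (can_comp (@sfunK s) (@sfunK t)) (can_comp (@sinvK t) (@sinvK s))
    (sinfM_fin s t).

Fact sinfMA : associative sinfM.
Proof. by move=> a b c; apply: Sinf_eq. Qed.

Fact sinf1M : left_id sinf1 sinfM.
Proof. by move=> a; apply: Sinf_eq. Qed.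

Fact sinfM1 : right_id sinf1 sinfM.
Proof. by move=> a; apply: Sinf_eq. Qed.

Fact sinfVM : left_inverse sinf1 sinfV sinfM.
Proof. by move=> a; apply: Sinf_eq; apply/funext => k /=; rewrite sfunK. Qed.

Fact sinfMV : right_inverse sinf1 sinfV sinfM.
Proof. by move=> a; apply: Sinf_eq; apply/funext => k /=; rewrite sinvK. Qed.

End SinfGroup.

HB.instance Definition _ :=
  isGroup.Build Sinf sinfMA sinf1M sinfM1 sinfVM sinfMV.

Definition swap0 (n k : nat) : nat :=
  if k == 0%N then n else if k == n then 0%N else k.

Fact swap0K n : involutive (swap0 n).
Proof.
move=> k; rewrite /swap0 /=.
have [->|k0] := eqVneq k 0%N; first by rewrite eqxx; case: (eqVneq n 0%N).
by have [->|kn] := eqVneq k n; [rewrite eqxx|rewrite (negbTE k0) (negbTE kn)].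
Qed.

Fact swap0_fin n : finite_set [set k | swap0 n k <> k].
Proof.
apply: (@sub_finite_set _ _ [set 0%N; n]); last exact: finite_set2.
move=> k; rewrite /swap0 /=.
have [->|k0] := eqVneq k 0%N; first by left.
by have [->|kn] := eqVneq k n; [right|].
Qed.

(* On {1, 2, ...} this is the transposition (1, n + 1), for [0 < n]. *)
Definition gamma (n : nat) : Sinf :=
  MkSinf (@swap0K n) (@swap0K n) (@swap0_fin n).

(* The two disjuncts account for the nonnegative and the negative powers. *)
Definition orbit_of (s : Sinf) (x : nat) : set nat :=
  [set y | exists k, y = iter k s x \/ x = iter k s y].

Definition orbits (s : Sinf) : set (set nat) := range (orbit_of s).

Definition psum (R : realType) (d : nat) (w : 'I_d -> R) (n : nat) : R :=
  \sum_(i < d) w i ^+ n.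

(* A finitely supported permutation has only finite orbits, and only finitely
   many of them have at least two elements, so both the cardinal and the
   product are the genuine ones. *)
Definition chi (R : realType) (d : nat) (w : 'I_d -> R) (s : Sinf) : R :=
  \big[*%R/1]_(V \in [set V | orbits s V /\ (2 <= #|` fset_set V|)%N])
     psum w #|` fset_set V|.

Definition lin_span (K : pzRingType) (V : lmodType K) (A : set V) : set V :=
  [set v | exists s : seq (K * V),
     (forall p, p \in s -> A p.2) /\ v = \sum_(p <- s) p.1 *: p.2].

Record hilbert (R : realType) := Hilbert {
  hcarrier :> completeNormedModType R[i];
  hdot : {dot hcarrier for Num.conj};
  hdot_norm : forall x : hcarrier, `|x| ^+ 2 = hdot x x }.

Definition bounded_op (R : realType) (H : hilbert R) (T : H -> H) : Prop :=
  linear T /\ continuous T.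

Definition selfadjoint (R : realType) (H : hilbert R) (T : H -> H) : Prop :=
  forall x y : H, hdot H (T x) y = hdot H x (T y).

(* The weak operator topology is the initial topology for [wot_map], where the
   functions from H * H to the complex numbers carry the topology of pointwise
   convergence. *)
Definition wot_map (R : realType) (H : hilbert R) (T : H -> H) :
    {ptws H * H -> R[i]^o} :=
  fun p => hdot H (T p.1) p.2.

Definition wot_closure (R : realType) (H : hilbert R) (A : set (H -> H)) :
    set (H -> H) :=
  bounded_op (H := H) `&` closure (A : set (initial_topology (@wot_map R H))).

Record gns (R : realType) (d : nat) (w : 'I_d -> R) := Gns {
  gH :> hilbert R;
  ghat : Sinf -> gH;
  ghat_dense : closure (lin_span (range ghat)) = setT;
  ghat_dot : forall s t, hdot gH (ghat s) (ghat t) = (chi w (s * t^-1)%g)%:C;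
  gU : Sinf -> gH -> gH;
  gU_bounded : forall s, bounded_op (gU s);
  gU1 : gU 1%g = id;
  gUM : forall s t, gU (s * t)%g = gU s \o gU t;
  gU_unitary : forall s x y, hdot gH (gU s x) (gU s y) = hdot gH x y;
  gU_hat : forall s t, gU s (ghat t) = ghat (s * t)%g }.

Definition gns_vN (R : realType) (d : nat) (w : 'I_d -> R) (G : gns w) :
    set (G -> G) :=
  wot_closure (lin_span (range (@gU R d w G))).

Definition tr (R : realType) (d : nat) (w : 'I_d -> R) (G : gns w)
    (T : G -> G) : R[i] :=
  hdot G (T (ghat G 1%g)) (ghat G 1%g).

Definition is_A0 (R : realType) (d : nat) (w : 'I_d -> R) (G : gns w)
    (A0 : G -> G) : Prop :=
  [/\ gns_vN A0, selfadjoint A0 &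
      forall x : G,
        ((n%:R : R[i])^-1 *: \sum_(1 <= i < n.+1) gU (gamma i) x)
          @[n --> \oo] --> A0 x].

Definition is_law (R : realType) (d : nat) (w : 'I_d -> R) (G : gns w)
    (T : G -> G) (mu : probability (measurableTypeR R) R) : Prop :=
  (exists2 K : set R, compact K & mu (~` K) = 0%E) /\
  (forall k : nat, (\int[mu]_t (t ^+ k : R))%:C = tr (iter k T)).

Definition fluct (R : realType) (d : nat) (w : 'I_d -> R) (G : gns w)
    (A0 : G -> G) (n : nat) : G -> G :=
  (Num.sqrt (n%:R : R))^-1%:C *: \sum_(1 <= i < n.+1) (gU (gamma i) - A0).

Definition weak_cvg (R : realType)
    (mu : nat -> probability (measurableTypeR R) R)
    (nu : probability (measurableTypeR R) R) : Prop :=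
  forall f : R -> R, continuous f -> bounded_fun f ->
    \int[mu n]_t f t @[n --> \oo] --> \int[nu]_t f t.

(* Main.v *)
(* Write X_i = U(gamma_i) - A_0. Since A_0 is a strong limit of averages of the
   U(gamma_l) and chi is a class function, the mixed moments of the X_i only
   involve values of chi on products of star transpositions in which A_0 is
   replaced by fresh, pairwise distinct letters. They are therefore invariant
   under injective relabelling of the indices, and vanish as soon as some index
   occurs exactly once. As in the exchangeable central limit theorem, only the
   index words without such a singleton contribute, which gives the convergence
   of every moment of the normalized sum and, uniformly in n, a bound
   72^k k^k on the moment of order 2k.

   With such bounds, sin(a t) and cos(a t) are approximated in L^1 by their Taylor
   polynomials, uniformly over all laws concerned. Writing a bounded continuous
   f as g(sin(t/L)) on a large interval and applying the Weierstrass theorem to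
   g, the same holds for f; hence the integrals of f converge and depend on
   the moments only. The limits are the integrals against a probability
   measure, obtained from its distribution function
   F(x) = inf { L(h) | h >= 1 on ]-oo, x] }, L being the limit functional. *)

From HB Require Import structures.
Require Import Defs.
From mathcomp Require Import all_boot all_order all_algebra.
From mathcomp Require Import finmap complex sesquilinear ring lra.
From mathcomp Require Import all_classical all_reals all_analysis.
From mathcomp Require Import measurable_realfun.

Set Implicit Arguments.
Unset Strict Implicit.
Unset Printing Implicit Defensive.

Import Order.TTheory GRing.Theory Num.Theory.
Import numFieldNormedType.Exports.

Local Open Scope classical_set_scope.
Local Open Scope ring_scope.

(** * Exchangeable functions on words *)

Section ExchangeableWords.
Context {R : realType}.
Implicit Types (phi c : seq nat -> R) (u v p s : seq nat) (f : nat -> nat).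

Definition exchangeable phi :=
  forall f s, {in s &, injective f} -> phi (map f s) = phi s.

(* [mixed phi N p u] expands the product of the letters of [p] with the
   differences [a - N_a], [a] in [u], where [N_a] are distinct letters that
   occur nowhere else. *)
Fixpoint mixed phi N p u : R :=
  if u is a :: v
  then mixed phi N (rcons p a) v - mixed phi N.+1 (rcons p N) v
  else phi p.

(** In the induction [f] is extended by sending the fresh letter [N] to [N']; the two bounds keep
    the extension injective. For [f] the identity this also shows that the choice of fresh letters
    does not matter. *)
Lemma mixed_map phi f N N' p u : exchangeable phi ->
  {in p ++ u &, injective f} ->
  (forall a, a \in p ++ u -> (a < N)%N) ->
  (forall a, a \in p ++ u -> (f a < N')%N) ->
  mixed phi N' (map f p) (map f u) = mixed phi N p u.
Proof.
move=> phiE; elim: u f N N' p => [|a u IH] f N N' p /=.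
  by rewrite cats0 => finj _ _; exact: phiE.
rewrite -cat_rcons => finj hN hN'; congr (_ - _); first by rewrite -map_rcons (IH f N N').
pose g x := if x == N then N' else f x.
have gE x : x \in rcons p a ++ u -> g x = f x.
  by move=> /hN xN; rewrite /g ltn_eqF.
have memr x : x \in rcons p N ++ u -> x != N -> x \in rcons p a ++ u.
  rewrite !mem_cat !mem_rcons !in_cons => + xN; rewrite (negbTE xN) /=.
  by move=> /orP[] ->; rewrite ?orbT.
have -> : map f u = map g u.
  by apply/eq_in_map => x xu; rewrite gE// mem_cat xu orbT.
have -> : rcons (map f p) N' = map g (rcons p N).
  rewrite map_rcons {2}/g eqxx; congr rcons; apply/eq_in_map => x xp.
  by rewrite gE// mem_cat mem_rcons in_cons xp orbT.
apply: IH.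
- move=> x y xi yi; rewrite /g.
  have [->|xN] := eqVneq x N; have [->|yN] := eqVneq y N => //.
  + by move=> E; have := hN' _ (memr _ yi yN); rewrite E ltnn.
  + by move=> E; have := hN' _ (memr _ xi xN); rewrite E ltnn.
  + by move=> E; apply: finj => //; exact: memr.
- move=> x xi; have [->//|xN] := eqVneq x N.
  by rewrite ltnS ltnW// hN// memr.
- move=> x xi; rewrite /g; have [//|xN] := eqVneq x N.
  by rewrite ltnS ltnW// hN'// memr.
Qed.

(** At the only occurrence of [a], the two terms of the difference differ by renaming [a] to the
    fresh letter [N], so exchangeability cancels them. At any earlier letter both terms vanish by
    induction. *)
Lemma mixed_singleton phi N p u a : exchangeable phi ->
  (forall b, b \in p ++ u -> (b < N)%N) ->
  a \notin p -> count_mem a u = 1%N -> mixed phi N p u = 0.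
Proof.
move=> phiE; elim: u N p => [|b u IH] N p //= hN ap.
have hN1 x : x \in rcons p N ++ u -> (x < N.+1)%N.
  rewrite mem_cat mem_rcons in_cons -orbA => /or3P[/eqP->//|xp|xu].
    by rewrite ltnS ltnW// hN// mem_cat xp.
  by rewrite ltnS ltnW// hN// mem_cat in_cons xu !orbT.
have [ba /= [] + |ba] := eqVneq b a; last first.
  rewrite add0n => au.
  have /hN aN : a \in p ++ b :: u.
    have au' : a \in u by rewrite -has_pred1 has_count au.
    by rewrite mem_cat in_cons au' !orbT.
  have apN : a \notin rcons p N by rewrite mem_rcons in_cons negb_or ap andbT ltn_eqF.
  have apb : a \notin rcons p b by rewrite mem_rcons in_cons negb_or ap andbT eq_sym.
  by rewrite (IH N (rcons p b))// ?(IH N.+1)// ?subrr// => x; rewrite cat_rcons; exact: hN.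
subst b; rewrite add0n => au; have {}au : a \notin u by rewrite -has_pred1 has_count au.
pose f x := if x == a then N else x.
have fE s : a \notin s -> map f s = s.
  move=> as'; rewrite -[RHS]map_id; apply/eq_in_map => x xs.
  by rewrite /f; case: eqVneq => // xa; rewrite -xa xs in as'.
have fa : f a = N by rewrite /f eqxx.
have fN x : x \in rcons p a ++ u -> (x < N)%N by rewrite cat_rcons; exact: hN.
rewrite -(@mixed_map phi f N N.+1)//.
- by rewrite map_rcons fa !fE// subrr.
- move=> x y /fN xN /fN yN; rewrite /f.
  have [->|_] := eqVneq x a; have [->|_] := eqVneq y a => //.
    by move=> E; rewrite -E ltnn in yN.
  by move=> E; rewrite E ltnn in xN.
- by move=> x /fN xN; rewrite /f; case: eqP => // _; exact: ltnW.
Qed.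

Lemma norm_mixed_le phi N p u : (forall s, `|phi s| <= 1) ->
  `|mixed phi N p u| <= 2 ^+ size u.
Proof.
move=> phi1; elim: u N p => [|a u IH] N p /=; first by rewrite expr0.
rewrite (le_trans (ler_normB _ _))// exprS.
by have := IH N (rcons p a); have := IH N.+1 (rcons p N); lra.
Qed.

(** Not a cumulant in the usual sense: for [phi = star_chi w] it is the joint moment of the centred
    operators [gU (gamma a.+1) - A0], by [centred_word_cumul]. *)
Definition cumul phi u := mixed phi (\max_(a <- u) a).+1 [::] u.

Lemma cumul_exchangeable phi : exchangeable phi -> exchangeable (cumul phi).
Proof.
move=> phiE f u finj.
apply: (@mixed_map phi f _ _ [::]) => // a au; rewrite ltnS.
  by rewrite leq_bigmax_seq.
by rewrite leq_bigmax_seq// map_f.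
Qed.

Lemma cumul_singleton phi u a : exchangeable phi ->
  count_mem a u = 1%N -> cumul phi u = 0.
Proof.
move=> phiE; apply: mixed_singleton => // b bu.
by rewrite ltnS leq_bigmax_seq.
Qed.

End ExchangeableWords.

(** * Sums of an exchangeable function over words: bounds and limits *)

Section ExchangeableCLT.
Context {R : realType}.
Context (c : seq nat -> R).
Hypothesis c_exch : exchangeable c.
Hypothesis c_single : forall u a, count_mem a u = 1%N -> c u = 0.
Hypothesis c_le : forall u, `|c u| <= 2 ^+ size u.
Implicit Types (u : seq nat) (n k l : nat).

(* The sum of [c (u ++ v)] over all words [v] of length [k] in the letters
   [0, ..., n - 1]. *)
Fixpoint wsum n k u : R :=
  if k is k'.+1 then \sum_(0 <= l < n) wsum n k' (rcons u l) else c u.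

Definition nsing u := count (fun x => count_mem x u == 1%N) u.

Lemma nsing_gt0 u : (0 < nsing u)%N -> c u = 0.
Proof. by rewrite -has_count => /hasP[a _ /eqP]; exact: c_single. Qed.

Lemma count_mem_rcons (x l : nat) u :
  count_mem x (rcons u l) = (count_mem x u + (l == x))%N.
Proof. by rewrite -cats1 count_cat /= addn0. Qed.

Lemma nsing_rcons_new u l : l \notin u -> nsing (rcons u l) = (nsing u).+1.
Proof.
move=> lu; rewrite /nsing -cats1 count_cat cats1 /= count_mem_rcons eqxx.
rewrite (count_memPn lu) add0n eqxx addn0 addn1; congr S.
apply/eq_in_count => x xu; rewrite count_mem_rcons.
by have [lx|_] := eqVneq l x; [rewrite lx xu in lu|rewrite addn0].
Qed.

Lemma nsing_rcons_single u l : count_mem l u = 1%N ->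
  nsing u = (nsing (rcons u l)).+1.
Proof.
move=> lu; rewrite /nsing -[in RHS]cats1 count_cat cats1 /= count_mem_rcons eqxx.
rewrite lu /= !addn0.
set P' := fun x => count_mem x (rcons u l) == 1%N.
(* On [u] the predicates [P'] and [pred1 l] are disjoint, and their union is the predicate of
   occurring exactly once in [u]. *)
have := count_predUI P' (pred1 l) u; rewrite lu addn1 => <-.
rewrite [X in (_ + X)%N](_ : _ = 0%N) ?addn0; last first.
  rewrite -(count_pred0 u); apply: eq_count => x /=; rewrite /P' count_mem_rcons.
  by have [->|_] := eqVneq x l; rewrite ?andbF// ?eqxx lu.
apply: eq_count => x /=; rewrite /P' count_mem_rcons eq_sym.
by have [->|_] := eqVneq x l; rewrite ?orbT ?orbF ?lu ?addn0 ?eqxx.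
Qed.

Lemma nsing_rcons_multi u l : (1 < count_mem l u)%N ->
  nsing (rcons u l) = nsing u.
Proof.
move=> lu; rewrite /nsing -cats1 count_cat cats1 /= count_mem_rcons eqxx addn1.
rewrite eqSS gtn_eqF ?(ltnW lu)// !addn0; apply: eq_count => x /=.
rewrite count_mem_rcons; have [<-|_] := eqVneq l x; last by rewrite addn0.
by rewrite addn1 eqSS !gtn_eqF// ltnW.
Qed.

Definition swapn (a b x : nat) : nat :=
  if x == a then b else if x == b then a else x.

Lemma swapnK a b : involutive (swapn a b).
Proof.
move=> x; rewrite /swapn; have [->|xa] := eqVneq x a.
  by have [->|_] := eqVneq b a; rewrite ?eqxx.
by have [->|xb] := eqVneq x b; rewrite ?eqxx// (negbTE xa) (negbTE xb).
Qed.

Lemma swapn_lt a b n x : (a < n)%N -> (b < n)%N -> (swapn a b x < n)%N = (x < n)%N.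
Proof.
by move=> an bn; rewrite /swapn; have [->|_] := eqVneq x a;
  [rewrite an bn|have [->|//] := eqVneq x b; rewrite an bn].
Qed.

(** The swap permutes the range of every summation index, and exchangeability absorbs it in the
    completed word. *)
Lemma wsum_swap n k a b u : (a < n)%N -> (b < n)%N ->
  wsum n k (map (swapn a b) u) = wsum n k u.
Proof.
move=> an bn; elim: k u => [|k IH] u /=.
  by apply: c_exch => x y _ _; exact: (can_inj (swapnK a b)).
rewrite [LHS](perm_big (map (swapn a b) (index_iota 0 n))) /=.
  by rewrite big_map; apply: eq_bigr => l _; rewrite -map_rcons IH.
rewrite perm_sym; apply: uniq_perm; rewrite ?map_inj_uniq ?iota_uniq//.
- exact: (can_inj (swapnK a b)).
- move=> x; rewrite mem_index_iota /=; apply/mapP/idP => [[y]|xn].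
    by rewrite mem_index_iota /= => yn ->; rewrite swapn_lt.
  by exists (swapn a b x); rewrite ?swapnK// mem_index_iota swapn_lt.
Qed.

Lemma wsum_new n k u a b : (a < n)%N -> (b < n)%N ->
  a \notin u -> b \notin u -> wsum n k (rcons u a) = wsum n k (rcons u b).
Proof.
move=> an bn au bu; rewrite -(@wsum_swap n k a b)// map_rcons.
congr (wsum n k (rcons _ _)); last by rewrite /swapn eqxx.
rewrite -[RHS]map_id; apply/eq_in_map => x xu; rewrite /swapn.
have [xa|_] := eqVneq x a; first by rewrite xa (negbTE au) in xu.
by have [xb|//] := eqVneq x b; rewrite xb (negbTE bu) in xu.
Qed.

(* The weight [sqrt n ^+ nsing u] makes the recursion on [k] homogeneous: the at
   most [n] fresh letters each create a singleton, whereas a letter of [u] removes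
   at most one, and only [minn n K <= sqrt (n * K)] of them remove none. *)
Lemma wsum_le n k u K : (0 < n)%N -> (size u + k <= K)%N ->
  `|wsum n k u| * Num.sqrt n%:R ^+ nsing u <=
  2 ^+ K * (3 * Num.sqrt K%:R) ^+ k * Num.sqrt K%:R ^+ nsing u
    * Num.sqrt n%:R ^+ k.
Proof.
move=> n0; set q : R := Num.sqrt n%:R.
have q0 : 0 < q by rewrite sqrtr_gt0 ltr0n.
have q0' := ltW q0.
have q2 : q * q = n%:R by rewrite -expr2 sqr_sqrtr.
elim: k u => [|k IH] u uK.
  rewrite !expr0 !mulr1 /=; have [->|] := posnP (nsing u); last first.
    by move=> /nsing_gt0 ->; rewrite normr0 mul0r mulr_ge0// exprn_ge0.
  rewrite !expr0 !mulr1 (le_trans (c_le _))// ler_eXn2l ?ltr1n//.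
  by move: uK; rewrite addn0.
set x : R := Num.sqrt K%:R; set B := 2 ^+ K * (3 * x) ^+ k.
have K0 : (0 < K)%N by rewrite (leq_trans _ uK)// addnS.
have x0 : 0 < x by rewrite sqrtr_gt0 ltr0n.
have x0' := ltW x0.
have x2 : x * x = K%:R by rewrite -expr2 sqr_sqrtr.
have B0 : 0 <= B by rewrite mulr_ge0 ?exprn_ge0 ?mulr_ge0.
(* One third of the bound: fresh letters, letters occurring once in [u] and letters occurring more
   often contribute at most [Z] each, whence the constant 3. *)
pose Z := B * x ^+ (nsing u).+1 * q ^+ k.+1.
have Z0 : 0 <= Z by rewrite /Z; apply: mulr_ge0; [apply: mulr_ge0 => //|]; exact: exprn_ge0.
have -> : 2 ^+ K * (3 * x) ^+ k.+1 * x ^+ nsing u * q ^+ k.+1 = Z + (Z + Z).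
  by rewrite /Z /B 2!exprS (exprS x); ring.
rewrite /= (le_trans (ler_wpM2r _ (ler_norm_sum _ _ _)))//.
  by rewrite exprn_ge0.
rewrite mulr_suml.
(* A fresh letter contributes at most [Z / n], a singleton of [u] at most [Z / K], a repeated letter
   of [u] at most [Z / (x * q)]. *)
have step l : `|wsum n k (rcons u l)| * q ^+ nsing u <=
    Z / n%:R + (l \in u)%:R * (Z / K%:R + Z / (x * q)).
  have : (size (rcons u l) + k <= K)%N by rewrite size_rcons addSnnS.
  move=> /IH; rewrite -/x -/B => H.
  have [lu|lu] := boolP (l \in u); last first.
    move: H; rewrite nsing_rcons_new// mul0r addr0 => H.
    rewrite -q2 ler_pdivlMr ?mulr_gt0//.
    apply: le_trans (_ : q * (`|wsum n k (rcons u l)| * q ^+ (nsing u).+1) <= _).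
      by rewrite exprS le_eqVlt; apply/orP; left; apply/eqP; ring.
    by rewrite (le_trans (ler_wpM2l (ltW q0) H))// /Z exprS le_eqVlt (exprS q);
      apply/orP; left; apply/eqP; ring.
  have Zn : 0 <= Z / n%:R by rewrite divr_ge0.
  have ZK : 0 <= Z / K%:R by rewrite divr_ge0.
  have Zxq : 0 <= Z / (x * q) by rewrite divr_ge0// mulr_ge0.
  rewrite mul1r.
  have : (0 < count_mem l u)%N by rewrite -has_count has_pred1.
  rewrite leq_eqVlt => /orP[/eqP/esym lu1|lu1].
    suff : `|wsum n k (rcons u l)| * q ^+ nsing u <= Z / K%:R by lra.
    rewrite ler_pdivlMr ?ltr0n// -x2; have E := nsing_rcons_single lu1.
    apply: le_trans (_ : (q * x * x) *
        (`|wsum n k (rcons u l)| * q ^+ (nsing (rcons u l))) <= _).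
      by rewrite E exprS le_eqVlt; apply/orP; left; apply/eqP; ring.
    apply: (le_trans (ler_wpM2l _ H)); first by rewrite !mulr_ge0.
    by rewrite /Z E !exprS le_eqVlt; apply/orP; left; apply/eqP; ring.
  suff : `|wsum n k (rcons u l)| * q ^+ nsing u <= Z / (x * q) by lra.
  rewrite ler_pdivlMr ?mulr_gt0//; move: H; rewrite nsing_rcons_multi// => H.
  rewrite mulrC; apply: (le_trans (ler_wpM2l _ H)); first by rewrite mulr_ge0.
  by rewrite /Z !exprS le_eqVlt; apply/orP; left; apply/eqP; ring.
apply: (le_trans (ler_sum _ (fun l _ => step l))).
rewrite big_split /= sumr_const_nat subn0 -mulr_suml -natr_sum.
set N := (\sum_(0 <= l < n) (l \in u))%N.
have NE : N = count (mem u) (iota 0 n).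
  rewrite /N -sum1_count [RHS]big_mkcond /= /index_iota subn0.
  by apply: eq_bigr => l _; case: (l \in u).
have Nn : (N <= n)%N by rewrite NE (leq_trans (count_size _ _))// size_iota.
have NK : (N <= K)%N.
  apply: (@leq_trans (size u)); last by rewrite (leq_trans _ uK)// leq_addr.
  rewrite NE -size_filter; apply: uniq_leq_size; first exact/filter_uniq/iota_uniq.
  by move=> l; rewrite mem_filter => /andP[].
(* [N] is bounded by [n] and by [K], so its square is at most [n * K], the square of [x * q]. *)
have Nxq : N%:R <= x * q.
  rewrite -(@ler_pXn2r _ 2) ?nnegrE ?mulr_ge0 ?(ltW x0) ?(ltW q0)//.
  rewrite exprMn !sqr_sqrtr// -natrX -natrM ler_nat -mulnn; exact: leq_mul.
rewrite -[X in X + _]mulr_natr divfK ?pnatr_eq0 -?lt0n// lerD2l mulrDr lerD//.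
  by rewrite mulrCA ler_piMr// ler_pdivrMr ?ltr0n// mul1r ler_nat.
by rewrite mulrCA ler_piMr// ler_pdivrMr ?mulr_gt0// mul1r.
Qed.

Lemma is_cvg_sum_nat (F : nat -> nat -> R) m : (forall l, cvgn (F l)) ->
  cvgn (fun n => \sum_(0 <= l < m) F l n).
Proof.
move=> HF; elim: m => [|m IH].
  by under eq_fun do rewrite big_geq//; exact: is_cvg_cst.
by under eq_fun do rewrite big_nat_recr//=; exact: is_cvgD.
Qed.

Lemma is_cvg_near_eq (f g : nat -> R) :
  (\forall n \near \oo, f n = g n) -> cvgn f -> cvgn g.
Proof.
move=> /near_eq_cvg fg /cvg_ex[l fl]; apply/cvg_ex; exists l.
exact: cvg_trans fg fl.
Qed.

(** Induction on [k]: appending a singleton of [u] preserves the normalization, a repeated letter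
    brings a factor [1 / sqrt n], a fresh one a factor [1 / n]. The fresh letters all contribute
    equally, and their number makes up for the factor [1 / n]. *)
Lemma is_cvg_wsum k u :
  cvgn (fun n => Num.sqrt n%:R ^+ nsing u * wsum n k u / Num.sqrt n%:R ^+ k).
Proof.
have cvgV : (n%:R^-1 : R) @[n --> \oo] --> 0.
  apply/gtr0_cvgV0; last exact: cvgr_idn.
  by near=> n; rewrite ltr0n; near: n; exact: nbhs_infty_gt.
have cvgVq : ((Num.sqrt n%:R)^-1 : R) @[n --> \oo] --> 0.
  under eq_fun do rewrite -sqrtrV//.
  have /continuous_cvg/(_ cvgV) := @sqrt_continuous R 0.
  by rewrite sqrtr0.
elim: k u => [|k IH] u.
  under eq_fun do rewrite expr0 divr1 /=.
  have [->|/nsing_gt0 ->] := posnP (nsing u).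
    by under eq_fun do rewrite expr0 mul1r; exact: is_cvg_cst.
  by under eq_fun do rewrite mulr0; exact: is_cvg_cst.
(* All letters from [m] on are fresh, so the sum over [l] splits into a fixed number of terms and
   [n - m] equal ones. *)
pose m := (\max_(a <- u) a).+1.
have m_fresh l : (m <= l)%N -> l \notin u.
  by move=> ml; apply: contraL ml => lu; rewrite -ltnNge ltnS leq_bigmax_seq.
pose F l n : R := Num.sqrt n%:R ^+ nsing u * wsum n k (rcons u l)
  / Num.sqrt n%:R ^+ k.+1.
pose G l n : R := Num.sqrt n%:R ^+ nsing (rcons u l) * wsum n k (rcons u l)
  / Num.sqrt n%:R ^+ k.
have FG l n : (0 < n)%N -> l \notin u -> F l n = n%:R^-1 * G l n.
  move=> n0 lu; rewrite /F /G nsing_rcons_new//.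
  have q0 : Num.sqrt n%:R != 0 :> R by rewrite sqrtr_eq0 -ltNge ltr0n.
  rewrite -[in n%:R^-1](@sqr_sqrtr R n%:R)// !exprS expr0; field.
  by rewrite ?expf_neq0 q0.
have Fcvg l : cvgn (F l).
  have [lu|lu] := boolP (l \in u); last first.
    apply: (@is_cvg_near_eq (fun n => n%:R^-1 * G l n)).
      by near=> n; rewrite FG//; near: n; exact: nbhs_infty_gt.
    by apply: is_cvgM; [apply/cvg_ex; exists 0|exact: IH].
  have : (0 < count_mem l u)%N by rewrite -has_count has_pred1.
  rewrite leq_eqVlt => /orP[/eqP/esym lu1|lu1].
    apply: (is_cvg_near_eq _ (IH (rcons u l))); near=> n.
    have q0 : Num.sqrt n%:R != 0 :> R.
      by rewrite sqrtr_eq0 -ltNge ltr0n; near: n; exact: nbhs_infty_gt.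
    by rewrite /F (nsing_rcons_single lu1) !exprS; field; rewrite ?expf_neq0 q0.
  apply: (@is_cvg_near_eq (fun n => (Num.sqrt n%:R)^-1 * G l n)).
    near=> n.
    have q0 : Num.sqrt n%:R != 0 :> R.
      by rewrite sqrtr_eq0 -ltNge ltr0n; near: n; exact: nbhs_infty_gt.
    by rewrite /F /G nsing_rcons_multi// !exprS; field; rewrite ?expf_neq0 q0.
  by apply: is_cvgM; [apply/cvg_ex; exists 0|exact: IH].
apply: (@is_cvg_near_eq (fun n =>
    \sum_(0 <= l < m) F l n + (1 - m%:R * n%:R^-1) * G m n)); last first.
  apply: is_cvgD; first exact: is_cvg_sum_nat.
  apply: is_cvgM; last exact: IH.
  apply: is_cvgB; first exact: is_cvg_cst.
  by apply: is_cvgM; [exact: is_cvg_cst|apply/cvg_ex; exists 0].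
near=> n.
have mn : (m < n)%N by near: n; exact: nbhs_infty_gt.
have n0 : (0 < n)%N by exact: leq_ltn_trans mn.
rewrite /= [in RHS](@big_cat_nat _ _ _ m) ?(ltnW mn)//=.
rewrite mulrDr mulrDl mulr_sumr mulr_suml; congr (_ + _).
have -> : \sum_(m <= l < n) wsum n k (rcons u l) =
    (n%:R - m%:R) * wsum n k (rcons u m).
  rewrite -natrB ?(ltnW mn)// mulr_natl -sumr_const_nat.
  by apply: eq_big_nat => l /andP[ml ln]; apply: wsum_new => //; exact: m_fresh.
have -> : G m n = n%:R * F m n.
  by rewrite FG ?m_fresh// mulVKf// pnatr_eq0 -lt0n.
have nN : n%:R != 0 :> R by rewrite pnatr_eq0 -lt0n.
have -> : (1 - m%:R * n%:R^-1) * (n%:R * F m n) = (n%:R - m%:R) * F m n.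
  by rewrite mulrA; congr (_ * _); rewrite mulrBl mul1r divfK.
by rewrite /F mulrA; congr (_ / _); rewrite mulrCA.
Unshelve. all: by end_near. Qed.

End ExchangeableCLT.

(** * Mixed moments of the star transpositions *)

Section FinitePermutations.
Implicit Types (s t : seq nat) (g h : Sinf).

Fact swapn_fin a b : finite_set [set k | swapn a b k <> k].
Proof.
apply: (@sub_finite_set _ _ [set a; b]); last exact: finite_set2.
move=> k; rewrite /swapn /=.
have [->|ka] := eqVneq k a; first by left.
by have [->|kb] := eqVneq k b; [right|].
Qed.

Definition sinf_swap a b : Sinf := MkSinf (@swapnK a b) (@swapnK a b) (@swapn_fin a b).

(** By induction: composing [g] with the transposition of [g a] and [b] sends [a] to [b], and leaves
    0 and the images already prescribed alone, as these differ from both [g a] and [b]. *)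
Lemma exists_sinf s t : uniq s -> uniq t -> size s = size t ->
  0%N \notin s -> 0%N \notin t -> exists2 g : Sinf, g 0%N = 0%N & map g s = t.
Proof.
elim: s t => [|a s IH] [|b t] //=; first by exists 1%g.
move=> /andP[aNs us] /andP[bNt ut] [] st.
rewrite !inE !negb_or => /andP[a0 s0] /andP[b0 t0].
have [g g0 gst] := IH t us ut st s0 t0.
have gI : injective g by exact: (can_inj (@sfunK g)).
exists (sinf_swap (g a) b * g)%g => /=; rewrite /swapn.
  rewrite g0; have [|_] := eqVneq 0%N (g a).
    by rewrite -{1}g0 => /gI a0'; rewrite a0' eqxx in a0.
  by rewrite (negbTE b0).
rewrite eqxx; congr (_ :: _); rewrite -gst; apply/eq_in_map => x xs /=.
have [/gI xa|_] := eqVneq (g x) (g a); first by rewrite -xa xs in aNs.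
have [gb|//] := eqVneq (g x) b; move: bNt.
by rewrite -gb -gst map_f.
Qed.

Lemma conj_gamma g a b : g 0%N = 0%N -> g a.+1 = b.+1 ->
  (g * gamma a.+1 * g^-1)%g = gamma b.+1.
Proof.
move=> g0 gab; apply: Sinf_eq; apply/funext => k /=.
have gK := @sfunK g; have Kg := @sinvK g; rewrite /swap0.
have [E|k0] := eqVneq (sinv g k) 0%N.
  by move: (Kg k); rewrite E g0 => <-.
have [E|ka] := eqVneq (sinv g k) a.+1.
  by move: (Kg k); rewrite E gab => <-; rewrite eqxx.
rewrite Kg; have [E|_] := eqVneq k 0%N.
  by move: k0; rewrite E -{1}g0 gK eqxx.
have [E|//] := eqVneq k b.+1.
by move: ka; rewrite E -gab gK eqxx.
Qed.

(* The letter [a] stands for [gamma a.+1], as [gamma 0] is the identity. *)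
Definition star_word s : Sinf := foldr (fun a g => (gamma a.+1 * g)%g) 1%g s.

Lemma star_word_rcons s a : star_word (rcons s a) = (star_word s * gamma a.+1)%g.
Proof. by elim: s => [|b s IH] /=; rewrite ?mulg1 ?mul1g// IH mulgA. Qed.

(** The relabelling extends to a permutation fixing the centre 0 of the star, and conjugation by it
    relabels each transposition of the product. *)
Lemma star_word_map (f : nat -> nat) s : {in s &, injective f} ->
  exists g : Sinf, star_word (map f s) = (g * star_word s * g^-1)%g.
Proof.
move=> finj.
have [|||||g g0 gE] := @exists_sinf (map S (undup s)) (map (S \o f) (undup s)).
- by rewrite map_inj_uniq ?undup_uniq// => ? ? [].
- rewrite map_inj_in_uniq ?undup_uniq// => x y.
  by rewrite !mem_undup => xs ys [] /finj; exact.
- by rewrite !size_map.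
- by apply/mapP => -[].
- by apply/mapP => -[].
exists g.
have {}gE a : a \in s -> g a.+1 = (f a).+1.
  rewrite -mem_undup; move: gE; rewrite -map_comp => /eq_in_map gE /gE; exact.
elim: s gE {finj} => [|a s IH] gE /=; first by rewrite mulg1 mulgV.
rewrite IH; last by move=> b bs; apply: gE; rewrite in_cons bs orbT.
rewrite -(@conj_gamma g a); [|by []|by apply: gE; rewrite mem_head].
by rewrite !mulgA -(mulgA _ g^-1%g g) mulVg mulg1.
Qed.

End FinitePermutations.

(** * Inner products and bounded operators *)

Section HilbertSpace.
Context {R : realType} (H : hilbert R).
Local Open Scope complex_scope.
Implicit Types x y z : H.

(** Cauchy-Schwarz, from Pythagoras applied to the component [a *: y] of [x] along [y] and the
    orthogonal remainder [z]. *)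
Lemma norm_hdot_le x y : `|hdot H x y| <= `|x| * `|y|.
Proof.
have [->|y0] := eqVneq y 0; first by rewrite linear0r normr0 mulr_ge0.
pose a := hdot H x y / hdot H y y; pose z := x - a *: y.
have yy0 : hdot H y y != 0 by rewrite dnorm_eq0.
have zy : hdot H z y = 0.
  by rewrite linearBl /= linearZl_LR /= divfK// subrr.
have xE : x = z + a *: y by rewrite subrK.
rewrite -(@ler_pXn2r _ 2)// ?nnegrE ?mulr_ge0// exprMn !hdot_norm.
have -> : hdot H x x = hdot H z z + `|a| ^+ 2 * hdot H y y.
  rewrite {1 2}xE hnormDd/=; last by rewrite linearZr_LR /= zy mulr0.
  by rewrite dnormZ.
have -> : hdot H x y = a * hdot H y y by rewrite divfK.
rewrite normrM exprMn [in `|hdot H y y|]ger0_norm ?dnorm_ge0//.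
by rewrite mulrDl expr2 !mulrA lerDr mulr_ge0 ?dnorm_ge0.
Qed.

End HilbertSpace.

Section BoundedOperators.
Context {R : realType} (H : hilbert R) (T : H -> H).
Hypothesis HT : bounded_op T.
Implicit Types x y : H.

Lemma bounded_opD x y : T (x + y) = T x + T y.
Proof. by have [+ _] := HT => /(_ 1 x y); rewrite !scale1r. Qed.

Lemma bounded_op0 : T 0 = 0.
Proof. by have := bounded_opD 0 0; rewrite addr0 => /eqP; rewrite addrC -subr_eq subrr => /eqP. Qed.

Lemma bounded_opZ (a : R[i]) x : T (a *: x) = a *: T x.
Proof. by have [+ _] := HT => /(_ a x 0); rewrite !addr0 bounded_op0 addr0. Qed.

Lemma bounded_opB x y : T (x - y) = T x - T y.
Proof. by rewrite bounded_opD -scaleN1r bounded_opZ scaleN1r. Qed.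

Lemma bounded_op_sum (I : Type) (r : seq I) (F : I -> H) :
  T (\sum_(i <- r) F i) = \sum_(i <- r) T (F i).
Proof.
elim: r => [|i r IH]; first by rewrite !big_nil bounded_op0.
by rewrite !big_cons bounded_opD IH.
Qed.

End BoundedOperators.

(** * Moments of the centred star transpositions in the GNS representation *)

Section GNS.
Context {R : realType} {d : nat} (w : 'I_d -> R) (G : gns w).
Local Open Scope complex_scope.
Implicit Types (g h : Sinf) (x y z : G) (p u s : seq nat).

Local Notation "''[' x , y ]" := (hdot G x y) : ring_scope.
Local Notation e := (ghat G 1%g).

Lemma chi1 : chi w 1%g = 1.
Proof.
rewrite /chi (_ : [set V | _] = set0) ?fsbig_set0//.
apply/seteqP; split => // V [[x _ <-]].
rewrite (_ : orbit_of 1%g x = [set x]) ?fset_set1 ?cardfs1//.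
have iter_id k (t : nat) : iter k (1%g : Sinf) t = t by elim: k => //= k ->.
apply/seteqP; split => y /=; last by move=> ->; exists 0%N; left.
by move=> [k]; rewrite !iter_id => -[].
Qed.

Lemma hdot_ghat1 g : '[ghat G g, e] = (chi w g)%:C.
Proof. by rewrite ghat_dot invg1 mulg1. Qed.

Lemma norm_ghat g : `|ghat G g| = 1.
Proof.
by apply/eqP; rewrite -(@pexpr_eq1 _ _ 2)// hdot_norm ghat_dot mulgV chi1.
Qed.

(** Read off from the unitarity of [gU g], which maps the vectors of [h] and of the unit to those of
    [g * h] and [g]; no orbits are counted. *)
Lemma chi_conj g h : chi w (g * h * g^-1)%g = chi w h.
Proof.
apply: complexI; rewrite -[RHS]hdot_ghat1 -[RHS](gU_unitary g).
by rewrite !gU_hat mulg1 ghat_dot.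
Qed.

Lemma norm_chi_le1 g : `|chi w g| <= 1.
Proof.
have := norm_hdot_le (ghat G g) e.
rewrite hdot_ghat1 !norm_ghat mulr1 normc_def /= expr0n addr0 sqrtr_sqr.
by rewrite -(lecR _ 1).
Qed.

Definition star_chi s := chi w (star_word s).

Lemma star_chi_exchangeable : exchangeable star_chi.
Proof.
by move=> f s finj; have [g gE] := star_word_map finj; rewrite /star_chi gE chi_conj.
Qed.

Lemma gU_norm g x : `|gU g x| = `|x|.
Proof.
by apply/eqP; rewrite -(@eqrXn2 _ 2)// !hdot_norm gU_unitary.
Qed.

(** The averages of an eventually constant sequence tend to the constant, and the assumed bound
    makes them tend to [v]. Quantitatively, a gap [z = v - beta] would satisfy
    [|z| < |z| / 2 + |S| / n] for large [n], so that [n * |z|] would stay bounded. *)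
Lemma cesaro_limit_unique (b : nat -> R[i]) (v beta : R[i]) (f : nat -> G) x N :
  (forall l, (N <= l)%N -> b l = beta) ->
  f n @[n --> \oo] --> x ->
  (forall n, `|v - n%:R^-1 * \sum_(0 <= l < n) b l| <= `|x - f n|) ->
  v = beta.
Proof.
move=> bN fx vb; apply/eqP; rewrite -subr_eq0; apply: contraT => vbeta.
pose z := v - beta; pose S := \sum_(0 <= l < N) (b l - beta).
have z0 : 0 < `|z| by rewrite normr_gt0.
(* Moduli are converted to elements of [R], where the Archimedean property provides the
   contradicting [n]. *)
have normcE' (t : R[i]) : `|t| = (complex.Re `|t|)%:C by rewrite normc_def.
pose a := complex.Re `|z|; pose s := complex.Re `|S|.
have a0 : 0 < a by rewrite -ltcR -normcE'.
have half : 0 < `|z| / 2 by rewrite divr_gt0.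
have near_lt : \forall n \near \oo, n%:R * a < 2 * s.
  move/cvgrPdist_lt : fx => /(_ _ half) fx; near=> n.
  have n0 : (0 < n)%N by near: n; exact: nbhs_infty_gt.
  have Nn : (N <= n)%N by near: n; exact: nbhs_infty_ge.
  have nR0 : 0 < n%:R :> R[i] by rewrite ltr0n.
  have nR : n%:R != 0 :> R[i] by rewrite gt_eqF.
  have zE : z = (v - n%:R^-1 * \sum_(0 <= l < n) b l) + n%:R^-1 * S.
    have -> : \sum_(0 <= l < n) b l = S + n%:R * beta.
      rewrite /S sumrB (@big_cat_nat _ _ _ N 0 n)//=.
      rewrite (@eq_big_nat _ _ _ N n _ (fun=> beta)); last first.
        by move=> l /andP[Nl _]; exact: bN.
      by rewrite !sumr_const_nat subn0 mulr_natl -{2}(subnK Nn) mulrnDr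
        (addrC (_ *+ (n - N))) addrA subrK.
    by rewrite /z mulrDr mulKf// opprD addrA addrAC subrK.
  rewrite -ltcR !rmorphM /= !rmorph_nat -!normcE'.
  have H1 : `|z| <= `|x - f n| + n%:R^-1 * `|S|.
    rewrite {1}zE (le_trans (ler_normD _ _))// lerD//.
    by rewrite normrM ger0_norm// invr_ge0 ltW.
  have H2 : `|z| < `|z| / 2 + n%:R^-1 * `|S|.
    by rewrite (le_lt_trans H1)// ltrD2r; near: n.
  have H3 : `|z| / 2 < n%:R^-1 * `|S|.
    by rewrite -(ltrD2l (`|z| / 2)) -splitr.
  by move: H3; rewrite ltr_pdivrMr// -mulrA ltr_pdivlMl// [2 * _]mulrC.
have [n [n1 n2]] : exists n, n%:R * a < 2 * s /\ 2 * s / a < n%:R.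
  near \oo => n; exists n; split; first by near: n.
  by near: n; exact: nbhs_infty_gtr.
by move: n2; rewrite ltr_pdivrMr// => /lt_trans/(_ n1); rewrite ltxx.
Unshelve. all: by end_near. Qed.

Lemma is_A0_bounded (A0 : G -> G) : is_A0 A0 -> bounded_op A0.
Proof. by case=> -[]. Qed.

Definition centred_word (A0 : G -> G) u x : G :=
  foldr (fun a y => gU (gamma a.+1) y - A0 y) x u.

Section CentredWords.
Context (A0 : G -> G).
Hypothesis HA0 : is_A0 A0.

Let A0b := is_A0_bounded HA0.
Let Ub g := gU_bounded G g.

Lemma centred_word_sum u (I : Type) (r : seq I) (F : I -> G) :
  centred_word A0 u (\sum_(i <- r) F i) =
  \sum_(i <- r) centred_word A0 u (F i).
Proof.
elim: u => //= a u ->.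
by rewrite (bounded_op_sum (Ub _)) (bounded_op_sum A0b) -sumrB.
Qed.

(** This is how [A0] becomes a fresh letter: [A0 y] is the limit of averages of [gU (gamma l.+1) y],
    and for [l >= N] the inner product with the [l]-th term does not depend on [l], by
    exchangeability. Its value at [l = N] is therefore the limit of the averages. *)
Lemma centred_word_mixed N p u : (forall a, a \in p ++ u -> (a < N)%N) ->
  '[gU (star_word p) (centred_word A0 u e), e] = (mixed star_chi N p u)%:C.
Proof.
elim: u N p => [|a u IH] N p /=.
  by move=> _; rewrite gU_hat mulg1 hdot_ghat1.
rewrite -cat_rcons => hN; set y := centred_word A0 u e.
rewrite (bounded_opB (Ub _)) linearBl /= rmorphB /=; congr (_ - _).
  rewrite -IH// star_word_rcons gUM//.
pose b l := '[gU (star_word (rcons p l)) y, e].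
have hN' l : (N <= l)%N -> forall c, c \in rcons p l ++ u -> (c < l.+1)%N.
  move=> Nl c; rewrite cat_rcons mem_cat in_cons => /or3P[cp|/eqP->//|cu].
    by rewrite ltnS (leq_trans _ Nl)// ltnW// hN// mem_cat mem_rcons in_cons cp orbT.
  by rewrite ltnS (leq_trans _ Nl)// ltnW// hN// mem_cat cu orbT.
have bE l : (N <= l)%N -> b l = (mixed star_chi N.+1 (rcons p N) u)%:C.
  move=> Nl; rewrite /b (IH l.+1); last exact: hN'.
  (* Renaming [l] to [N] turns the word with letter [l] into the one with letter [N]. *)
  pose f (c : nat) := if c == l then N else c.
  have fE s : (forall c, c \in s -> (c < N)%N) -> map f s = s.
    move=> sN; rewrite -[RHS]map_id; apply/eq_in_map => c /sN cN.
    by rewrite /f ltn_eqF// (leq_trans cN).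
  have hpN c : c \in p -> (c < N)%N.
    by move=> cp; rewrite hN// mem_cat mem_rcons in_cons cp orbT.
  have huN c : c \in u -> (c < N)%N by move=> cu; rewrite hN// mem_cat cu orbT.
  have fl : f l = N by rewrite /f eqxx.
  congr _%:C; rewrite -(@mixed_map _ _ f l.+1 N.+1).
  - by rewrite map_rcons fl !fE.
  - exact: star_chi_exchangeable.
  - have memN c : c \in rcons p l ++ u -> c != l -> (c < N)%N.
      by rewrite cat_rcons mem_cat in_cons => /or3P[/hpN//|->//|/huN//].
    move=> c c' ci c'i; rewrite /f.
    have [->|cl] := eqVneq c l; have [->|c'l] := eqVneq c' l => //.
      by move=> E; have := memN _ c'i c'l; rewrite -E ltnn.
    by move=> E; have := memN _ ci cl; rewrite E ltnn.
  - exact: hN'.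
  - move=> c; rewrite cat_rcons mem_cat in_cons /f.
    have [//|cl] := eqVneq c l.
    by move=> /or3P[/hpN/ltnW//|//|/huN/ltnW].
have [_ _ /(_ y) cvgA0] := HA0.
apply: (cesaro_limit_unique bE cvgA0) => n.
have -> : \sum_(0 <= l < n) b l =
    '[gU (star_word p) (\sum_(1 <= i < n.+1) gU (gamma i) y), e].
  rewrite (bounded_op_sum (Ub _)) linear_sumlz big_add1 /=.
  by apply: eq_bigr => l _; rewrite /b star_word_rcons gUM.
rewrite -linearZl_LR -linearBl -(bounded_opZ (Ub _)) -(bounded_opB (Ub _)).
by rewrite (le_trans (norm_hdot_le _ _))// norm_ghat mulr1 gU_norm.
Qed.

Lemma centred_word_cumul u :
  '[centred_word A0 u e, e] = (cumul star_chi u)%:C.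
Proof.
have := @centred_word_mixed (\max_(a <- u) a).+1 [::] u.
by rewrite /= gU1; apply=> a au; rewrite ltnS leq_bigmax_seq.
Qed.

(** The outermost factor of the power acts right after the word, so its expansion appends a letter
    to [u]: this is the recursion of [wsum]. *)
Lemma centred_word_iter n k u :
  let S := \sum_(1 <= i < n.+1) (gU (gamma i) - A0) in
  '[centred_word A0 u (iter k S e), e] = (wsum (cumul star_chi) n k u)%:C.
Proof.
move=> S; elim: k u => [|k IH] u; first exact: centred_word_cumul.
rewrite iterS /= {1}/S fct_sumE centred_word_sum linear_sumlz rmorph_sum /=.
rewrite big_add1 /=; apply: eq_bigr => l _.
by rewrite -IH /centred_word -cats1 foldr_cat.
Qed.

Lemma tr_iter_fluct n k :
  tr (iter k (fluct A0 n)) =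
  ((Num.sqrt n%:R)^-1 ^+ k * wsum (cumul star_chi) n k [::])%:C.
Proof.
rewrite /tr /fluct; set S := \sum_(1 <= i < n.+1) _; set a := (Num.sqrt _)^-1.
rewrite rmorphM /= -(centred_word_iter n k [::]) -/S /=.
have SZ (c : R[i]) x : S (c *: x) = c *: S x.
  rewrite /S !fct_sumE scaler_sumr; apply: eq_bigr => i _.
  rewrite -[LHS]/(gU (gamma i) (c *: x) - A0 (c *: x)).
  by rewrite (bounded_opZ (Ub _)) (bounded_opZ A0b) -scalerBr.
suff -> : iter k (a%:C *: S) e = (a ^+ k)%:C *: iter k S e by rewrite linearZl_LR.
elim: k => [|k IH]; first by rewrite expr0 scale1r.
rewrite !iterS {}IH -[LHS]/(a%:C *: S ((a ^+ k)%:C *: iter k S e)).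
by rewrite SZ scalerA -rmorphM /= -exprS.
Qed.

End CentredWords.

End GNS.

(** * Polynomial approximation under moment bounds *)

Section TaylorPolynomials.
Context {R : realType}.
Implicit Types (N : nat) (x : R).

Let norm_le_of_derive_ge0 (h dh : R -> R) N :
  (forall x : R, is_derive x (1 : R) h (dh x)) -> h 0 = 0 ->
  (forall x, 0 <= x -> `|dh x| <= x ^+ N / N`!%:R) ->
  forall x, 0 <= x -> `|h x| <= x ^+ N.+1 / (N.+1)`!%:R.
Proof.
move=> hd h0 dhle x x0.
(* The sign [s] treats both halves of the absolute value at once. The function [g] below vanishes at
   0 and has a nonnegative derivative on the positive axis, so the mean value theorem applies. *)
suff H (s : R) : `|s| = 1 -> s * h x <= x ^+ N.+1 / (N.+1)`!%:R.
  rewrite ler_norml; have := H 1; have := H (-1); rewrite normrN normr1; lra.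
move=> s1; pose g t := (N.+1)`!%:R^-1 * t ^+ N.+1 - s * h t.
have gd (t : R) : is_derive t (1 : R) g (t ^+ N / N`!%:R - s * dh t).
  have := is_deriveB (is_deriveZ (N.+1)`!%:R^-1
    (is_deriveX N.+1 (is_derive_id t (1 : R)))) (is_deriveZ s (hd t)).
  rewrite (_ : _ - _ = g); last by apply/funext => u; rewrite /g !fctE.
  move=> H; apply: (is_derive_eq H); congr (_ - _); rewrite /GRing.scale /= mulr1 factS natrM invfM.
  by field; rewrite nat1r !pnatr_eq0 -lt0n fact_gt0.
have gc : continuous g by move=> t; apply/differentiable_continuous/derivable1_diffP; exact: ex_derive.
have [c] := @MVT_segment _ g _ 0 x x0 (fun t _ => gd t) (continuous_subspaceT gc).
rewrite in_itv /= => /andP[c0 _]; rewrite subr0 /g h0 expr0n /= !mulr0 !subr0.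
rewrite -subr_ge0 mulrC => ->; rewrite mulr_ge0// subr_ge0.
by rewrite (le_trans (ler_norm _))// normrM s1 mul1r dhle.
Qed.

Lemma norm_le_of_derive (h dh : R -> R) N :
  (forall x : R, is_derive x (1 : R) h (dh x)) -> h 0 = 0 ->
  (forall x, `|dh x| <= `|x| ^+ N / N`!%:R) ->
  forall x, `|h x| <= `|x| ^+ N.+1 / (N.+1)`!%:R.
Proof.
move=> hd h0 dhle x; have [x0|/ltW x0] := leP 0 x.
  rewrite (ger0_norm x0); apply: (norm_le_of_derive_ge0 hd h0) => // t t0.
  by rewrite (le_trans (dhle t))// ger0_norm.
rewrite (ler0_norm x0) -{1}[x]opprK; pose k t := h (- t).
have kd (t : R) : is_derive t (1 : R) k (dh (- t) * - 1).
  exact: is_derive1_comp.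
apply: (norm_le_of_derive_ge0 kd).
- by rewrite /k oppr0.
- move=> t t0; rewrite normrM normrN normr1 mulr1 (le_trans (dhle _))//.
  by rewrite normrN ger0_norm.
- by rewrite oppr_ge0.
Qed.

Definition sin_poly N : {poly R} :=
  \poly_(i < N) (if odd i then (-1) ^+ i./2 / i`!%:R else 0).
Definition cos_poly N : {poly R} :=
  \poly_(i < N) (if odd i then 0 else (-1) ^+ i./2 / i`!%:R).

Lemma deriv_sin_poly N : (sin_poly N.+1)^`() = cos_poly N.
Proof.
apply/polyP => i; rewrite coef_deriv !coef_poly ltnS /=.
case: ifP => // _; last by rewrite mul0rn.
case: (boolP (odd i)) => oi /=; first by rewrite mul0rn.
rewrite uphalf_half (negbTE oi) add0n factS natrM invfM -mulr_natl.
by field; rewrite nat1r !pnatr_eq0 -lt0n fact_gt0.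
Qed.

Lemma deriv_cos_poly N : (cos_poly N.+1)^`() = - sin_poly N.
Proof.
apply/polyP => i; rewrite coef_deriv coefN !coef_poly ltnS /=.
case: ifP => // _; last by rewrite mul0rn oppr0.
case: (boolP (odd i)) => oi /=; last by rewrite mul0rn oppr0.
rewrite uphalf_half oi add1n factS natrM invfM -mulr_natl exprS.
by field; rewrite nat1r !pnatr_eq0 -lt0n fact_gt0.
Qed.

(** The bounds are proved jointly: up to sign, the remainder of order [N.+1] of either function has
    the remainder of order [N] of the other as its derivative. *)
Lemma sin_cos_poly_le N x :
  `|sin x - (sin_poly N).[x]| <= `|x| ^+ N / N`!%:R /\
  `|cos x - (cos_poly N).[x]| <= `|x| ^+ N / N`!%:R.
Proof.
elim: N x => [|N IH] x.
  rewrite /sin_poly /cos_poly !poly_def !big_ord0 !horner0 !subr0 divr1.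
  by rewrite sin_max cos_max.
split; move: x.
- apply: (@norm_le_of_derive _ (fun t => cos t - (cos_poly N).[t])).
  + by move=> t; rewrite -deriv_sin_poly; exact: is_deriveB.
  + by rewrite sin0 horner_coef0 coef_poly /= subr0.
  + by move=> t; have [] := IH t.
- apply: (@norm_le_of_derive _ (fun t => - sin t - (- sin_poly N).[t])).
  + by move=> t; rewrite -deriv_cos_poly; exact: is_deriveB.
  + by rewrite cos0 horner_coef0 coef_poly /= expr0 divr1 subrr.
  + by move=> t; have [+ _] := IH t; rewrite hornerN opprK -normrN opprD opprK.
Qed.

End TaylorPolynomials.

(** * Approximation by polynomials in mean, uniformly over laws with bounded moments *)

Section MomentBounds.
Context {R : realType}.
Local Notation prob := (probability (measurableTypeR R) R).
Implicit Types (mu : prob) (f g : R -> R) (p : {poly R}) (C : R).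

(* The factor [(2k)!/k!] is what makes the Taylor expansions of the sine and the
   cosine converge in [L^1(mu)], at every scale and uniformly in [mu]. *)
Definition moment_bound C mu :=
  (forall k, mu.-integrable setT (EFin \o (fun t : R => t ^+ k))) /\
  (forall k, \int[mu]_t (t ^+ k.*2) <= C ^+ k * (k.*2)`!%:R / k`!%:R).

Definition bounded_by (M : R) f := forall x, `|f x| <= M.

Lemma bounded_by_fun M f : bounded_by M f -> bounded_fun f.
Proof. by move=> fM; exists M; split; rewrite ?num_real// => y /ltW My x _ /=; rewrite (le_trans (fM x)). Qed.

Lemma bounded_fun_bounded_by f : bounded_fun f -> exists M, bounded_by M f.
Proof. by move=> [M [_ fM]]; exists (M + 1) => x; apply: fM; rewrite ?ltrDl. Qed.

Lemma integrable_cb mu f M : continuous f -> bounded_by M f ->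
  mu.-integrable setT (EFin \o f).
Proof.
move=> cf /bounded_by_fun bf; apply: measurable_bounded_integrable => //.
  by rewrite -ge0_fin_numE// fin_num_measure.
exact: continuous_measurable_fun.
Qed.

Lemma Rintegral_prob_cst mu (c : R) : \int[mu]_t c = c.
Proof.
transitivity (c * fine (1%E : \bar R)); last by rewrite mulr1.
rewrite Rintegral_cst//; congr (_ * fine _); exact: probability_setT.
Qed.

Lemma integrable_sum_EFin mu (I : Type) (r : seq I) (F : I -> R -> R) :
  (forall i, mu.-integrable setT (EFin \o F i)) ->
  mu.-integrable setT (EFin \o (fun t => \sum_(i <- r) F i t)).
Proof.
move=> iF; under [EFin \o _]eq_fun do rewrite /= -sumEFin.
by apply: integrable_sum => // i _; exact: iF.
Qed.

Lemma Rintegral_sum mu (I : Type) (r : seq I) (F : I -> R -> R) :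
  (forall i, mu.-integrable setT (EFin \o F i)) ->
  \int[mu]_t (\sum_(i <- r) F i t) = \sum_(i <- r) \int[mu]_t F i t.
Proof.
move=> iF; elim: r => [|i r IH].
  under eq_Rintegral do rewrite big_nil.
  by rewrite Rintegral_cst// mul0r big_nil.
under eq_Rintegral do rewrite big_cons.
by rewrite RintegralD ?IH ?big_cons//; exact: integrable_sum_EFin.
Qed.

Lemma integrable_scale mu f (c : R) : mu.-integrable setT (EFin \o f) ->
  mu.-integrable setT (EFin \o (fun t => c * f t)).
Proof.
by move=> fi; under [EFin \o _]eq_fun do rewrite /= EFinM; exact: integrableZl.
Qed.

Section Polynomials.
Context (C : R) (mu : prob).
Hypothesis muC : moment_bound C mu.

Lemma integrable_poly p : mu.-integrable setT (EFin \o horner p).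
Proof.
have -> : EFin \o horner p = EFin \o (fun t => \sum_(i < size p) p`_i * t ^+ i).
  by apply/funext => t /=; rewrite horner_coef.
by apply: integrable_sum_EFin => i; apply: integrable_scale; exact: muC.1.
Qed.

Lemma Rintegral_poly p :
  \int[mu]_t p.[t] = \sum_(i < size p) p`_i * \int[mu]_t (t ^+ i).
Proof.
under eq_Rintegral do rewrite horner_coef.
rewrite Rintegral_sum; last by move=> i; apply: integrable_scale; exact: muC.1.
by apply: eq_bigr => i _; rewrite RintegralZl//; exact: muC.1.
Qed.

Lemma integrable_cb_poly f M p : continuous f -> bounded_by M f ->
  mu.-integrable setT (EFin \o (fun t => f t - p.[t])).
Proof.
move=> cf fM; have := integrableB measurableT (integrable_cb mu cf fM) (integrable_poly p).
by apply: eq_integrable.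
Qed.

Lemma integrable_norm f : mu.-integrable setT (EFin \o f) ->
  mu.-integrable setT (EFin \o (fun t => `|f t|)).
Proof.
by move=> /integrable_abse; apply: eq_integrable.
Qed.

End Polynomials.

(** The polynomial is chosen before the measure, so one [p] serves all laws obeying the moment
    bound; passing to limits along [mu n] rests on this uniformity. *)
Definition poly_L1_approx C f := exists2 M, continuous f /\ bounded_by M f &
  forall eps : R, 0 < eps -> exists p, forall mu, moment_bound C mu ->
    \int[mu]_t `|f t - p.[t]| <= eps.

Lemma le_Rintegral_lin mu f g h (c : R) :
  mu.-integrable setT (EFin \o f) -> mu.-integrable setT (EFin \o g) ->
  mu.-integrable setT (EFin \o h) -> (forall t, h t <= c * f t + g t) ->
  \int[mu]_t h t <= c * \int[mu]_t f t + \int[mu]_t g t.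
Proof.
move=> fi gi hi hfg; have cfi := integrable_scale c fi.
rewrite -RintegralZl// -RintegralD//; apply: le_Rintegral => //.
by have := integrableD measurableT cfi gi; apply: eq_integrable.
Qed.

Lemma poly_L1_approx_lin C (c : R) f g : poly_L1_approx C f ->
  poly_L1_approx C g -> poly_L1_approx C (fun t => c * f t + g t).
Proof.
move=> [M [cf fM] fP] [M' [cg gM] gP].
have chc : continuous (fun t => c * f t + g t).
  by move=> x; apply: cvgD; [apply: cvgM; [exact: cvg_cst|exact: cf]|exact: cg].
have hM : bounded_by (`|c| * M + M') (fun t => c * f t + g t).
  move=> x; rewrite (le_trans (ler_normD _ _))// lerD ?gM// normrM.
  by rewrite ler_wpM2l// fM.
exists (`|c| * M + M') => // eps eps0.
have c1 : 0 < `|c| + 1 by rewrite ltr_wpDl.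
have [|p pP] := fP (eps / (2 * (`|c| + 1))).
  by rewrite divr_gt0// mulr_gt0.
have [|q qP] := gP (eps / 2); first by rewrite divr_gt0.
exists (c *: p + q) => mu muC.
have i1 := integrable_norm (integrable_cb_poly muC p cf fM).
have i2 := integrable_norm (integrable_cb_poly muC q cg gM).
have i3 := integrable_norm (integrable_cb_poly muC (c *: p + q) chc hM).
apply: (le_trans (@le_Rintegral_lin _ _ _ _ `|c| i1 i2 i3 _)).
  move=> t; rewrite hornerD hornerZ -normrM mulrBr.
  by rewrite (le_trans _ (ler_normD _ _))// opprD addrACA.
rewrite [leRHS](splitr eps) lerD ?qP//.
apply: (le_trans (ler_wpM2l _ (pP _ muC))) => //.
have -> : `|c| * (eps / (2 * (`|c| + 1))) = eps / 2 * (`|c| / (`|c| + 1)).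
  by field; rewrite gt_eqF.
by rewrite ler_piMr ?divr_ge0 ?(ltW eps0)// ler_pdivrMr// mul1r lerDl.
Qed.

(** The factor [(2k)!] in the moment bound cancels that of the Taylor remainder of order [2k], whose
    integral is thus at most [(a^2 C)^k / k!], a null sequence. *)
Lemma poly_L1_approx_trig C (a : R) :
  poly_L1_approx C (fun t => sin (a * t)) /\
  poly_L1_approx C (fun t => cos (a * t)).
Proof.
have ca : continuous (fun t => a * t) by move=> t; exact: mulrl_continuous.
have cs : continuous (fun t => sin (a * t)).
  by move=> t; apply: continuous_comp; [exact: ca|exact: continuous_sin].
have cc : continuous (fun t => cos (a * t)).
  by move=> t; apply: continuous_comp; [exact: ca|exact: continuous_cos].
have sM : bounded_by 1 (fun t => sin (a * t)) by move=> t; exact: sin_max.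
have cM : bounded_by 1 (fun t => cos (a * t)) by move=> t; exact: cos_max.
have key eps : 0 < eps -> exists k, forall mu, moment_bound C mu ->
    \int[mu]_t (a ^+ k.*2 / (k.*2)`!%:R * t ^+ k.*2) <= eps.
  move=> eps0; have /cvgrPdist_lt/(_ _ eps0) := @cvg_exp_coeff R (a ^+ 2 * C).
  move=> [k _ /(_ k (leqnn k))]; rewrite sub0r normrN /exp_coeff /= => kE.
  exists k => mu muC; rewrite RintegralZl//; last exact: muC.1.
  rewrite (le_trans _ (ltW (le_lt_trans (ler_norm _) kE)))//.
  have a0 : 0 <= a ^+ k.*2 / (k.*2)`!%:R.
    by rewrite divr_ge0// -muln2 exprM sqr_ge0.
  apply: (le_trans (ler_wpM2l a0 (muC.2 k))).
  rewrite exprMn -exprM mul2n le_eqVlt; apply/orP; left; apply/eqP.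
  by field; rewrite !pnatr_eq0 -!lt0n !fact_gt0.
have rem f p k : continuous f -> bounded_by 1 f ->
  (forall t, `|f t - p.[a * t]| <= `|a * t| ^+ k.*2 / (k.*2)`!%:R) ->
  forall mu, moment_bound C mu ->
  \int[mu]_t `|f t - (p \Po (a *: 'X)).[t]| <=
  \int[mu]_t (a ^+ k.*2 / (k.*2)`!%:R * t ^+ k.*2).
  move=> cf fM fp mu muC; apply: le_Rintegral => //.
  - exact: integrable_norm (integrable_cb_poly muC _ cf fM).
  - apply: integrable_scale; exact: muC.1.
  - move=> t _; rewrite horner_comp hornerZ hornerX (le_trans (fp t))//.
    have -> : `|a * t| ^+ k.*2 = (a * t) ^+ k.*2.
      by rewrite -mul2n !exprM real_normK ?num_real.
    by rewrite exprMn mulrAC.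
split.
- exists 1 => // eps /key[k kP]; exists (sin_poly k.*2 \Po (a *: 'X)) => mu muC.
  apply: le_trans (rem _ _ k cs sM _ _ muC) (kP _ muC) => t.
  exact: (sin_cos_poly_le _ _).1.
- exists 1 => // eps /key[k kP]; exists (cos_poly k.*2 \Po (a *: 'X)) => mu muC.
  apply: le_trans (rem _ _ k cc cM _ _ muC) (kP _ muC) => t.
  exact: (sin_cos_poly_le _ _).2.
Qed.

Lemma poly_L1_approx_ext C f g : f =1 g ->
  poly_L1_approx C f -> poly_L1_approx C g.
Proof. by move=> /funext ->. Qed.

(** Only linear combinations preserve approximability so far, so products are linearized: one factor
    [sin (a * t)] is absorbed by replacing [b] with [b + a] and [b - a]. Hence [b] stays general in
    the induction. *)
Lemma poly_L1_approx_sinX C (a : R) k (b : R) :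
  poly_L1_approx C (fun t => sin (a * t) ^+ k * sin (b * t)) /\
  poly_L1_approx C (fun t => sin (a * t) ^+ k * cos (b * t)).
Proof.
elim: k b => [|k IH] b.
  have [s c] := poly_L1_approx_trig C b; split.
    by apply: poly_L1_approx_ext s => t; rewrite expr0 mul1r.
  by apply: poly_L1_approx_ext c => t; rewrite expr0 mul1r.
have [sp cp] := IH (b + a); have [sm cm] := IH (b - a).
have z : poly_L1_approx C (fun=> 0).
  have [+ _] := poly_L1_approx_trig C 0; apply: poly_L1_approx_ext => t.
  by rewrite mul0r sin0.
split.
- have := poly_L1_approx_lin 2^-1 cm (poly_L1_approx_lin (- 2^-1) cp z).
  apply: poly_L1_approx_ext => t.
  rewrite [(b + a) * t]mulrDl [(b - a) * t]mulrBl cosB cosD exprS; by field.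
- have := poly_L1_approx_lin 2^-1 sp (poly_L1_approx_lin (- 2^-1) sm z).
  apply: poly_L1_approx_ext => t.
  rewrite [(b + a) * t]mulrDl [(b - a) * t]mulrBl sinB sinD exprS; by field.
Qed.

Lemma poly_L1_approx_poly_sin C (a : R) p :
  poly_L1_approx C (fun t => p.[sin (a * t)]).
Proof.
have H k : poly_L1_approx C (fun t => sin (a * t) ^+ k).
  have [_] := poly_L1_approx_sinX C a k 0; apply: poly_L1_approx_ext => t.
  by rewrite mul0r cos0 mulr1.
have z : poly_L1_approx C (fun=> 0).
  have [+ _] := poly_L1_approx_trig C 0; apply: poly_L1_approx_ext => t.
  by rewrite mul0r sin0.
suff S n : poly_L1_approx C (fun t => \sum_(i < n) p`_i * sin (a * t) ^+ i).
  by apply: poly_L1_approx_ext (S (size p)) => t; rewrite horner_coef.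
elim: n => [|n IH].
  by apply: poly_L1_approx_ext z => t; rewrite big_ord0.
apply: poly_L1_approx_ext (poly_L1_approx_lin p`_n (H n) IH) => t.
by rewrite big_ord_recr addrC.
Qed.

End MomentBounds.

(** * The Weierstrass theorem by Bernstein polynomials *)

Section Weierstrass.
Context {R : realType}.
Implicit Types (f g : R -> R) (eps : R).

(** Heine's theorem, in a form where only [x] is confined to the interval and [y] may leave it. *)
Lemma uniformly_continuous_itv g (a b eps : R) : continuous g -> 0 < eps ->
  exists2 delta, 0 < delta & forall x y, a <= x <= b -> `|x - y| < delta ->
    `|g x - g y| < eps.
Proof.
move=> cg eps0.
have e2 : 0 < eps / 2 by rewrite divr_gt0.
(* The distance [d] is a parameter tending to 0 from the right; compactness makes one [d] work for
   all [x]. *)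
have /compact_near_coveringP/(_ R (0 : R)^'+ (fun d x =>
    forall y, `|x - y| < d -> `|g x - g y| < eps) _) := @segment_compact R a b.
case=> [x _|].
  have /cvgrPdist_lt/(_ _ e2) [/= eta eta0 gx] := cg x.
  have h0 : 0 < eta / 2 by rewrite divr_gt0.
  exists (ball x (eta / 2), [set d | d < eta / 2]).
    split; first exact: nbhsx_ballx.
    exact: nbhs_right_lt.
  move=> [z d] /= [xz dh] y zy.
  have gz := gx z (lt_trans xz _).
  have gy : `|g x - g y| < eps / 2.
    apply: gx => /=; rewrite -(subrKA z) (le_lt_trans (ler_normD _ _))//.
    by rewrite (splitr eta) ltrD// (lt_trans zy).
  rewrite -(subrKA (g x)) (le_lt_trans (ler_normD _ _))// (splitr eps) ltrD//.
  by rewrite distrC gz// ltr_pdivrMr// ltr_pMr// ltr1n.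
move=> d /= d0 H; exists (d / 2); first by rewrite divr_gt0.
move=> x y xab; apply: (H (d / 2)) => //=.
- by rewrite sub0r normrN gtr0_norm ?divr_gt0// ltr_pdivrMr// ltr_pMr// ltr1n.
- by rewrite divr_gt0.
Qed.

(* [bernstein n f] is the expectation of [f] under the binomial law with
   parameters [n] and ['X]; the recursion conditions on the first trial. *)
Fixpoint bernstein (n : nat) (f : nat -> R) : {poly R} :=
  if n is m.+1
  then 'X * bernstein m (fun k => f k.+1) + (1 - 'X) * bernstein m f
  else (f 0%N)%:P.

Section Bernstein.
Context (x : R).
Hypothesis x01 : 0 <= x <= 1.

Local Notation B n f := (bernstein n f).[x].

Lemma bernsteinS n (f : nat -> R) :
  B n.+1 f = x * B n (fun k => f k.+1) + (1 - x) * B n f.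
Proof. by rewrite /= !hornerE. Qed.

Lemma bernstein_lin n (a : R) (f g : nat -> R) :
  B n (fun k => a * f k + g k) = a * B n f + B n g.
Proof.
elim: n f g => [|n IH] f g; first by rewrite /= !hornerE.
by rewrite !bernsteinS !IH; ring.
Qed.

Lemma le_bernstein n (f g : nat -> R) : (forall k, f k <= g k) ->
  B n f <= B n g.
Proof.
have /andP[x0 x1] := x01.
elim: n f g => [|n IH] f g fg; first by rewrite /= !hornerE.
by rewrite !bernsteinS lerD// ler_wpM2l ?IH// subr_ge0.
Qed.

Lemma bernstein_cst n (c : R) : B n (fun=> c) = c.
Proof.
elim: n => [|n IH]; first by rewrite /= !hornerE.
by rewrite !bernsteinS !IH; ring.
Qed.

(** Variance plus squared bias of the binomial law. The centre [c] is free because a success in the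
    first trial shifts it by 1. *)
Lemma bernstein_sqr n (c : R) : B n (fun k => (k%:R - c) ^+ 2) =
  n%:R * x * (1 - x) + (n%:R * x - c) ^+ 2.
Proof.
elim: n c => [|n IH] c; first by rewrite /= !hornerE; ring.
rewrite bernsteinS IH.
have -> : (fun k => (k.+1%:R - c) ^+ 2) = (fun k => (k%:R - (c - 1)) ^+ 2).
  by apply/funext => k; congr (_ ^+ 2); rewrite -natr1; ring.
by rewrite IH -natr1; ring.
Qed.

End Bernstein.

Lemma weierstrass01 g M eps : continuous g -> (forall x, `|g x| <= M) ->
  0 < eps -> exists p : {poly R}, forall x, 0 <= x <= 1 -> `|g x - p.[x]| <= eps.
Proof.
move=> cg gM eps0.
have e2 : 0 < eps / 2 by rewrite divr_gt0.
have [d d0 gd] := uniformly_continuous_itv 0 1 cg e2.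
have M0 : 0 <= M by rewrite (le_trans _ (gM 0)).
(* Chebyshev's argument: when [|x - y| >= d], the trivial bound [2 * M] is at most
   [K * (y - x) ^+ 2]. *)
pose K := 2 * M / d ^+ 2.
have K0 : 0 <= K by apply: divr_ge0; [exact: mulr_ge0|exact: sqr_ge0].
have gK x y : 0 <= x <= 1 -> `|g x - g y| <= K * (y - x) ^+ 2 + eps / 2.
  move=> x01; have [xy|xy] := ltP `|x - y| d.
    by rewrite (le_trans (ltW (gd _ _ x01 xy)))// lerDr mulr_ge0// sqr_ge0.
  apply: (@le_trans _ _ (2 * M)).
    by rewrite (le_trans (ler_normB _ _))// mulrDl mul1r lerD.
  rewrite (@le_trans _ _ (K * d ^+ 2))//.
    by rewrite divfK// expf_eq0 gt_eqF.
  rewrite -[leLHS]addr0 lerD// ?(ltW e2)// ler_wpM2l//.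
  by rewrite -[leRHS]real_normK ?num_real// ler_sqr ?nnegrE ?(ltW d0)// distrC.
(* The frequency of successes has variance [x * (1 - x) / n], so this [n] brings the quadratic term
   below [eps / 2]. *)
pose n := (Num.truncn (2 * K / eps)).+1.
have n0 : 0 < n%:R :> R by rewrite ltr0n.
have nK : K / n%:R <= eps / 2.
  have : 2 * K / eps < n%:R by exact: truncnS_gt.
  rewrite ler_pdivrMr// ltr_pdivrMr//; move: (n%:R : R) => z; lra.
exists (bernstein n (fun k => g (k%:R / n%:R))) => x x01.
have /andP[x0 x1] := x01.
pose f k := g (k%:R / n%:R).
pose h k := K / n%:R ^+ 2 * (k%:R - n%:R * x) ^+ 2 + eps / 2.
have pt k : `|g x - f k| <= h k.
  rewrite (le_trans (gK _ _ x01))// lerD2r le_eqVlt; apply/orP; left; apply/eqP.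
  by field; rewrite gt_eqF.
have H : `|g x - (bernstein n f).[x]| <= (bernstein n h).[x].
  have : (bernstein n f).[x] <= (bernstein n (fun k => 1 * h k + g x)).[x].
    apply: (le_bernstein x01) => k; have := pt k; rewrite ler_norml.
    by move: (h k) (f k) => a b; lra.
  have : (bernstein n (fun=> g x)).[x] <= (bernstein n (fun k => 1 * h k + f k)).[x].
    apply: (le_bernstein x01) => k; have := pt k; rewrite ler_norml.
    by move: (h k) (f k) => a b; lra.
  rewrite !bernstein_lin !bernstein_cst ler_norml.
  by move: (_ .[x]) (_ .[x]) => a b; lra.
rewrite (le_trans H)// bernstein_lin bernstein_cst bernstein_sqr subrr expr0n addr0.
rewrite [leRHS](splitr eps) lerD// (le_trans _ nK)//.
have -> : K / n%:R ^+ 2 * (n%:R * x * (1 - x)) = K / n%:R * (x * (1 - x)).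
  by field; rewrite gt_eqF.
have xx : x * (1 - x) <= 1 by nra.
by rewrite ler_piMr// divr_ge0// ltW.
Qed.

Lemma weierstrass g M eps : continuous g -> bounded_by M g -> 0 < eps ->
  exists p : {poly R}, forall x, -1 <= x <= 1 -> `|g x - p.[x]| <= eps.
Proof.
move=> cg gM eps0.
have [||p pP] := @weierstrass01 (fun t => g (2 * t - 1)) M eps _ _ eps0.
- move=> t; apply: continuous_comp; last exact: cg.
  by apply: cvgB; [exact: mulrl_continuous|exact: cvg_cst].
- by move=> x; exact: gM.
exists (p \Po (2^-1 *: ('X + 1))) => x x11.
have := pP (2^-1 * (x + 1)); rewrite horner_comp hornerZ hornerD hornerX hornerC /=.
have -> : 2 * (2^-1 * (x + 1)) - 1 = x by field.
by apply; lra.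
Qed.

End Weierstrass.

(** * From trigonometric to all bounded continuous functions *)

Section BoundedContinuousApproximation.
Context {R : realType}.
Local Notation prob := (probability (measurableTypeR R) R).
Implicit Types (mu : prob) (f g : R -> R) (p : {poly R}) (C M : R).

(* The argument of [asin] is kept away from the end points of its domain, where
   continuity is not available. *)
Definition clamp (t : R) : R := Num.max (- 2^-1) (Num.min t 2^-1).

Lemma clamp_itv t : - 2^-1 <= clamp t <= 2^-1.
Proof.
rewrite /clamp le_max lexx ge_max ge_min lexx orbT andbT /=; lra.
Qed.

Lemma clamp_id t : - 2^-1 <= t <= 2^-1 -> clamp t = t.
Proof. by move=> /andP[t1 t2]; rewrite /clamp min_l// max_r. Qed.

Lemma continuous_asin_clamp : continuous (fun t => asin (clamp t)).
Proof.
move=> t; apply: (@continuous_comp _ _ _ clamp (@asin R)).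
  apply: continuous_max; first exact: cst_continuous.
  by apply: continuous_min; [exact: id|exact: cst_continuous].
by apply: continuous_asin; have := clamp_itv t; lra.
Qed.

Lemma asin_half_gt0 : 0 < asin (2^-1 : R).
Proof.
have h : (2^-1 : R) \in `[(-1), 1] by rewrite in_itv /=; lra.
rewrite ltNge; apply/negP => a0.
have : sin (asin (2^-1 : R)) <= sin 0.
  have a1 := @asin_geNpi2 R 2^-1; have a2 := @asin_lepi2 R 2^-1.
  have p0 := pi_gt0 R.
  rewrite le_eqVlt; move: a0; rewrite le_eqVlt => /orP[/eqP->|a0].
    by rewrite eqxx.
  apply/orP; right; rewrite ltr_sin// in_itv /=; last by lra.
  by rewrite a1 ?a2//; lra.
by rewrite asinK// sin0; lra.
Qed.

Lemma asin_clamp_sin (z : R) : `|z| <= asin 2^-1 -> asin (clamp (sin z)) = z.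
Proof.
rewrite ler_norml => /andP[z1 z2].
have a2 := @asin_lepi2 R 2^-1.
have h : (2^-1 : R) \in `[(-1), 1] by rewrite in_itv /=; lra.
have hpi : asin (2^-1 : R) <= pi / 2 by apply: a2; lra.
have le_sin (x y : R) : - (pi / 2) <= x -> x <= y -> y <= pi / 2 -> sin x <= sin y.
  move=> x1; rewrite le_eqVlt => /orP[/eqP->//|xy] y2.
  by apply: ltW; rewrite ltr_sin// in_itv /=; lra.
rewrite clamp_id.
  by apply: sinK; rewrite in_itv /=; lra.
apply/andP; split; last by rewrite -[leRHS](asinK h); apply: le_sin => //; lra.
by rewrite -[in leLHS](asinK h) -sinN; apply: le_sin; lra.
Qed.

Lemma poly_L1_approx_cb C f M : continuous f -> bounded_by M f ->
  poly_L1_approx C f.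
Proof.
move=> cf fM; exists M => // eps eps0.
have M0 : 0 <= M by rewrite (le_trans _ (fM 0)).
have th0 := asin_half_gt0; set th : R := asin 2^-1 in th0.
(* Chosen so that the tail error [2 * M / A ^+ 2 * (2 * |C|)] is at most [eps / 4]; the summand 1
   ensures [A <= A ^+ 2]. *)
pose A := 16 * M * `|C| / eps + 1.
have A1 : 1 <= A by rewrite lerDr divr_ge0 ?(ltW eps0)// !mulr_ge0.
have A0 : 0 < A by lra.
(* For [|t| <= A] the angle [t / L] is at most [asin 2^-1] in absolute value, so [clamp] is inactive
   and [g (sin (t / L)) = f t]. *)
pose L := A / th.
have L0 : 0 < L by rewrite divr_gt0.
pose g y := f (L * asin (clamp y)).
have cg : continuous g.
  move=> y; apply: continuous_comp; last exact: cf.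
  by apply: cvgM; [exact: cvg_cst|exact: continuous_asin_clamp].
have e4 : 0 < eps / 4 by rewrite divr_gt0.
have e2 : 0 < eps / 2 by rewrite divr_gt0.
have [|p pP] := @weierstrass _ g M (eps / 4) cg _ e4.
  by move=> y; exact: fM.
pose h t := p.[sin (L^-1 * t)].
have [M' [ch hM'] hP] := poly_L1_approx_poly_sin C L^-1 p.
have [q qP] := hP _ e2; exists q => mu muC.
(* Beyond [A] the difference of [f] and [g] is at most [2 * M], which the quadratic term dominates,
   with its integral controlled by the second moment. *)
have pt t : `|f t - h t| <= 2 * M / A ^+ 2 * t ^+ 2 + eps / 4.
  have s1 : -1 <= sin (L^-1 * t) <= 1 by rewrite sin_geN1 sin_le1.
  have c0 : 0 <= 2 * M / A ^+ 2.
    by apply: divr_ge0; [exact: mulr_ge0|exact: sqr_ge0].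
  have ht := pP _ s1; have [tA|tA] := leP `|t| A.
    have gE : g (sin (L^-1 * t)) = f t.
      rewrite /g asin_clamp_sin ?mulVKf ?gt_eqF//.
      rewrite normrM normfV (gtr0_norm L0) mulrC ler_pdivrMr//.
      by rewrite -/th mulrC divfK// gt_eqF.
    by rewrite -gE (le_trans ht)// lerDr mulr_ge0// sqr_ge0.
  rewrite -(subrKA (g (sin (L^-1 * t)))) (le_trans (ler_normD _ _))// lerD//.
  apply: (@le_trans _ _ (2 * M)).
    by rewrite (le_trans (ler_normB _ _))// mulrDl mul1r lerD ?fM.
  apply: (@le_trans _ _ (2 * M / A ^+ 2 * A ^+ 2)).
    by rewrite divfK// expf_eq0 gt_eqF.
  apply: ler_wpM2l => //; rewrite -[leRHS]real_normK ?num_real//.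
  by rewrite ler_pXn2r ?nnegrE ?normr_ge0 ?(ltW A0) ?(ltW tA).
have i1 := integrable_norm (integrable_cb_poly muC q cf fM).
have i2 := integrable_norm (integrable_cb_poly muC q ch hM').
have i3 := integrable_scale (2 * M / A ^+ 2) (muC.1 2%N).
have i4 : mu.-integrable setT (EFin \o (fun t : R => `|h t - q.[t]| + eps / 4)).
  have := integrableD measurableT i2
    (@integrable_cb _ mu (cst (eps / 4)) (eps / 4) _ _).
  move=> H; apply: eq_integrable (H _ _) => //.
  - exact: cst_continuous.
  - by move=> t; rewrite ger0_norm// ltW.
apply: le_trans (_ : 2 * M / A ^+ 2 * \int[mu]_t (t ^+ 2) +
    \int[mu]_t (`|h t - q.[t]| + eps / 4) <= _).
  apply: (le_Rintegral_lin _ i4 i1); first exact: muC.1.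
  move=> t /=; have := ler_distD (h t) (f t) q.[t]; have := pt t.
  by move: (2 * M / A ^+ 2 * t ^+ 2) => X; lra.
rewrite RintegralD//; last first.
  apply: (@integrable_cb _ mu (cst (eps / 4)) (eps / 4)).
    exact: cst_continuous.
  by move=> t; rewrite ger0_norm// ltW.
rewrite Rintegral_prob_cst.
have c0 : 0 <= 2 * M / A ^+ 2.
  by apply: divr_ge0; [exact: mulr_ge0|exact: sqr_ge0].
have t2 : \int[mu]_t (t ^+ 2) <= 2 * `|C|.
  rewrite (le_trans (muC.2 1%N))// expr1 divr1 mulrC.
  by rewrite ler_wpM2l// ler_norm.
have AC : 2 * M / A ^+ 2 * (2 * `|C|) <= eps / 4.
  rewrite mulrAC ler_pdivrMr ?exprn_gt0//.
  have AA : A <= A ^+ 2 by rewrite expr2 ler_peMr// ltW.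
  have : 16 * M * `|C| / eps <= A by rewrite lerDl.
  rewrite ler_pdivrMr// => H.
  have : A * eps <= A ^+ 2 * eps by rewrite ler_wpM2r// ltW.
  move: H; move: (A ^+ 2) (M) `|C| => A2 M1 C1; lra.
apply: (le_trans (lerD (le_trans (ler_wpM2l c0 t2) AC)
  (lerD (qP _ muC) (lexx _)))).
lra.
Qed.

End BoundedContinuousApproximation.

(** * The limiting measure *)

Section StieltjesProbability.
Context {R : realType} (F : R -> R).
Hypothesis F_nd : {homo F : x y / x <= y}.
Hypothesis F_rc : right_continuous F.
Hypothesis F_Ny : F x @[x --> -oo%R] --> (0 : R).
Hypothesis F_y : F x @[x --> +oo%R] --> (1 : R).

#[local] HB.instance Definition _ := isCumulative.Build R _ R F F_nd F_rc.
#[local] HB.instance Definition _ := isCumulativeBounded.Build R 0 1 F F_Ny F_y.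

Lemma exists_probability_cdf :
  exists nu : probability (measurableTypeR R) R,
    forall r, nu `]-oo, r]%classic = (F r)%:E.
Proof.
by exists (lebesgue_stieltjes_measure F) => r; exact: (cdf_lebesgue_stieltjes_id F r).
Qed.

End StieltjesProbability.

(** * States on bounded continuous functions and their distribution functions *)

Section RampInterpolation.
Context {R : realType}.
Implicit Types (f g : R -> R) (a b t : R).

(** For [a < b], a continuous substitute for the indicator of a left half-line: 1 up to [a], 0 from
    [b] on, affine in between. *)
Definition ramp a b t : R := Num.max 0 (Num.min 1 ((b - t) / (b - a))).

Lemma ramp_itv a b t : 0 <= ramp a b t <= 1.
Proof. by rewrite /ramp le_max lexx ge_max ge_min lexx ler01. Qed.

Lemma ramp1 a b t : a < b -> t <= a -> ramp a b t = 1.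
Proof.
move=> ab ta; rewrite /ramp min_l ?max_r//.
by rewrite ler_pdivlMr ?subr_gt0// mul1r lerD2l lerN2.
Qed.

Lemma ramp0 a b t : a < b -> b <= t -> ramp a b t = 0.
Proof.
move=> ab bt; rewrite /ramp max_l// ge_min; apply/orP; right.
by rewrite ler_pdivrMr ?subr_gt0// mul0r subr_le0.
Qed.

Lemma continuous_ramp a b : continuous (ramp a b).
Proof.
move=> t; apply: (@continuous_max _ _ (fun=> 0)
  (fun t => Num.min 1 ((b - t) / (b - a)))); first exact: cst_continuous.
apply: (@continuous_min _ _ (fun=> 1)); first exact: cst_continuous.
by apply: cvgM; [apply: cvgB; [exact: cvg_cst|exact: cvg_id]|exact: cvg_cst].
Qed.

Definition Cb f := continuous f /\ exists M, bounded_by M f.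

Lemma Cb_ramp a b : Cb (ramp a b).
Proof.
split; first exact: continuous_ramp.
by exists 1 => t; have /andP[r0 r1] := ramp_itv a b t; rewrite ger0_norm.
Qed.

Lemma Cb_cst (c : R) : Cb (fun=> c).
Proof. by split; [exact: cst_continuous|exists `|c|]. Qed.

Lemma Cb_lin (c : R) f g : Cb f -> Cb g -> Cb (fun t => c * f t + g t).
Proof.
move=> [cf [M fM]] [cg [N gN]]; split.
  by move=> x; apply: cvgD; [apply: cvgM; [exact: cvg_cst|exact: cf]|exact: cg].
exists (`|c| * M + N) => x; rewrite (le_trans (ler_normD _ _))// lerD ?gN//.
by rewrite normrM ler_wpM2l ?fM.
Qed.

Section Interpolation.
Context (f : R -> R) (x : nat -> R) (B eps : R).
Hypothesis x_incr : forall j, x j < x j.+1.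
Hypothesis fB : bounded_by B f.

Local Notation c j := (f (x j) - f (x j.+1)).

(* Piecewise linear between the nodes [x 0, ..., x m], constant outside. *)
Fixpoint interp m t : R :=
  if m is k.+1 then c k * ramp (x k) (x k.+1) t + (interp k t - c k)
  else f (x 0%N).

Lemma interp_cb m : Cb (interp m).
Proof.
elim: m => [|m IH]; first exact: Cb_cst.
apply: Cb_lin; first exact: Cb_ramp.
have := Cb_lin 1 IH (Cb_cst (- c m)).
by congr Cb; apply/funext => t; rewrite mul1r.
Qed.

Lemma interp_right m t : x m <= t -> interp m t = f (x m).
Proof.
elim: m => //= m IH xt; rewrite ramp0// mulr0 add0r IH; first by ring.
exact: le_trans (ltW (x_incr m)) xt.
Qed.

(** Between consecutive nodes the value is a convex combination of two nodal values of [f]; the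
    constant 3 is generous. *)
Lemma interp_le m t : `|interp m t| <= 3 * B.
Proof.
have B0 : 0 <= B by rewrite (le_trans _ (fB 0)).
elim: m => [|m IH] /=; first by rewrite (le_trans (fB _))// ler_peMl//; lra.
have [tm|/ltW tm] := leP t (x m).
  by rewrite ramp1// mulr1 addrC subrK.
have /andP[r0 r1] := ramp_itv (x m) (x m.+1) t; rewrite interp_right//.
have -> : c m * ramp (x m) (x m.+1) t + (f (x m) - c m) =
  ramp (x m) (x m.+1) t * f (x m) + (1 - ramp (x m) (x m.+1) t) * f (x m.+1).
  by ring.
have := fB (x m); have := fB (x m.+1); rewrite !ler_norml; nra.
Qed.

Lemma interp_close m t : (forall j, (j < m)%N -> `|c j| <= eps) ->
  (forall j t, (j < m)%N -> x j <= t <= x j.+1 ->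
    `|f t - f (x j.+1)| <= eps) ->
  0 <= eps -> x 0%N <= t <= x m -> `|f t - interp m t| <= 2 * eps.
Proof.
elim: m => [|m IH] /= c_le f_osc eps0 /andP[t0 tm].
  have -> : t = x 0%N by apply/eqP; rewrite eq_le tm t0.
  by rewrite subrr normr0 mulr_ge0.
have [tm'|/ltW tm'] := leP t (x m).
  rewrite ramp1// mulr1 [X in _ - X]addrC subrK IH ?t0//.
    by move=> j jm; apply: c_le; exact: ltnW.
  by move=> j y jm; apply: f_osc; exact: ltnW.
have /andP[r0 r1] := ramp_itv (x m) (x m.+1) t; rewrite interp_right//.
have -> : f t - (c m * ramp (x m) (x m.+1) t + (f (x m) - c m)) =
  (f t - f (x m.+1)) - c m * ramp (x m) (x m.+1) t by ring.
rewrite (le_trans (ler_normB _ _))// [leRHS]mulr_natl mulr2n lerD//.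
  by apply: f_osc; rewrite ?ltnSn// tm' tm.
by rewrite normrM (ger0_norm r0) (le_trans _ (c_le m (ltnSn m)))// ler_piMr.
Qed.

End Interpolation.

(** A positive normalized linear functional. Neither countable additivity nor tightness is part of
    it: mass may escape to infinity, unless [has_cdf] holds for some [F] with limits 0 and 1. *)
Definition cb_state (L : (R -> R) -> R) :=
  [/\ forall (c : R) f g, Cb f -> Cb g ->
        L (fun t => c * f t + g t) = c * L f + L g,
      forall f g, Cb f -> Cb g -> (forall t, f t <= g t) -> L f <= L g &
      forall c, L (fun=> c) = c].

Section States.
Context (F : R -> R).
Hypothesis F_Ny : F x @[x --> -oo%R] --> (0 : R).
Hypothesis F_y : F x @[x --> +oo%R] --> (1 : R).

(** Indicators are not continuous, so [F] is tied to [L] by squeezing the value on a ramp. *)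
Definition has_cdf (L : (R -> R) -> R) := forall a b, a < b ->
  F a <= L (ramp a b) <= F b.

Lemma cb_state_sub L f g : cb_state L -> Cb f -> Cb g ->
  L (fun t => f t - g t) = L f - L g.
Proof.
move=> [Llin _ _] cf cg; have := Llin (- 1) g f cg cf; rewrite mulN1r addrC => <-.
by congr L; apply/funext => t; rewrite mulN1r addrC.
Qed.

Lemma cb_state_close L f g T (K eta : R) : cb_state L -> Cb f -> Cb g -> Cb T ->
  (forall t, `|f t - g t| <= K * T t + eta) -> `|L f - L g| <= K * L T + eta.
Proof.
move=> [Llin Lmono Lcst] fC gC TC fg.
have LT : L (fun t => K * T t + eta) = K * L T + eta.
  by rewrite Llin ?Lcst//; exact: Cb_cst.
have TC' := Cb_lin K TC (Cb_cst eta).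
have H1 : L f <= 1 * L g + (K * L T + eta).
  rewrite -LT -Llin//; apply: Lmono => //; first exact: Cb_lin.
  by move=> t; have := fg t; rewrite ler_norml; lra.
have H2 : L g <= 1 * L f + (K * L T + eta).
  rewrite -LT -Llin//; apply: Lmono => //; first exact: Cb_lin.
  by move=> t; have := fg t; rewrite ler_norml; lra.
by rewrite ler_norml; lra.
Qed.

Lemma cdf_tails (tau : R) : 0 < tau ->
  exists2 A, 1 < A & F (1 - A) <= tau /\ 1 - tau <= F (A - 1).
Proof.
move=> tau0.
have /cvgrPdist_lt/(_ _ tau0)[a [_ aF]] := F_Ny.
have /cvgrPdist_lt/(_ _ tau0)[b [_ bF]] := F_y.
have na := ler_norm (- a); have nb := ler_norm b; rewrite normrN in na.
have a0 := normr_ge0 a; have b0 := normr_ge0 b.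
exists (`|a| + `|b| + 2); first by lra.
have := aF (1 - (`|a| + `|b| + 2)); have := bF (`|a| + `|b| + 2 - 1).
move=> /(_ _)/ltW + /(_ _)/ltW; rewrite !ler_distlC.
by move=> /(_ ltac:(lra)) + /(_ ltac:(lra)); lra.
Qed.

(** The interpolant is a combination of ramps. On each ramp both states lie between consecutive
    values of [F], so they differ by at most the increment, and the increments telescope. *)
Lemma cb_state_interp L L' f (x : nat -> R) (eps : R) m :
  cb_state L -> cb_state L' -> has_cdf L -> has_cdf L' ->
  (forall j, x j < x j.+1) ->
  (forall j, (j < m)%N -> `|f (x j) - f (x j.+1)| <= eps) -> 0 <= eps ->
  `|L (interp f x m) - L' (interp f x m)| <= eps * (F (x m) - F (x 0%N)).
Proof.
move=> SL SL' LF L'F x_incr.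
have step M k : cb_state M -> M (interp f x k.+1) =
    (f (x k) - f (x k.+1)) * M (ramp (x k) (x k.+1)) +
    (M (interp f x k) - (f (x k) - f (x k.+1))).
  move=> SM; have [Mlin _ Mcst] := SM; rewrite /= Mlin; first last.
  - split=> [t|].
      apply: cvgB; last exact: cvg_cst; exact: (interp_cb f x k).1.
    have [N iN] := (interp_cb f x k).2.
    exists (N + `|f (x k) - f (x k.+1)|) => t.
    by rewrite (le_trans (ler_normB _ _))// lerD.
  - exact: Cb_ramp.
  - by rewrite cb_state_sub// ?Mcst//; [exact: interp_cb|exact: Cb_cst].
elim: m => [_ _|m IH c_le eps0].
  by have [_ _ Lc] := SL; have [_ _ L'c] := SL'; rewrite /= Lc L'c !subrr normr0 mulr0.
have {}IH := IH (fun j jm => c_le j (ltnW jm)) eps0.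
have {}c_le := c_le m (ltnSn m).
have r_le : `|L (ramp (x m) (x m.+1)) - L' (ramp (x m) (x m.+1))|
    <= F (x m.+1) - F (x m).
  by have := LF _ _ (x_incr m); have := L'F _ _ (x_incr m); rewrite ler_norml; lra.
rewrite !step//; set c := f _ - f _ in c_le *; set u := L (interp _ _ _) in IH *.
set u' := L' (interp _ _ _) in IH *; set r := L _ in r_le *; set r' := L' _ in r_le *.
have -> : c * r + (u - c) - (c * r' + (u' - c)) = c * (r - r') + (u - u') by ring.
rewrite (le_trans (ler_normD _ _))//.
have -> : eps * (F (x m.+1) - F (x 0%N)) =
  eps * (F (x m.+1) - F (x m)) + eps * (F (x m) - F (x 0%N)) by ring.
by rewrite lerD// normrM ler_pM.
Qed.

Lemma cb_state_eq L L' f : cb_state L -> cb_state L' ->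
  has_cdf L -> has_cdf L' -> Cb f -> L f = L' f.
Proof.
move=> SL SL' LF L'F fC; have [cf [B fB]] := fC.
have B0 : 0 <= B by rewrite (le_trans _ (fB 0)).
apply/eqP; rewrite -subr_eq0 -normr_le0; apply/ler_addgt0Pl => e e0; rewrite addr0.
(* The total error is twice [4 * B * (2 * tau) + 2 * eps], from replacing [f] by [g] under each
   state, plus [eps] on [g]: that is [16 * B * tau + 5 * eps], at most [e]. *)
pose eps := e / 10; pose tau := e / (32 * (B + 1)).
have eps0 : 0 < eps by rewrite divr_gt0.
have tau0 : 0 < tau by rewrite divr_gt0// mulr_gt0// ltr_wpDl.
have Btau : 16 * B * tau <= e / 2.
  rewrite /tau mulrA ler_pdivrMr; last by rewrite mulr_gt0// ltr_wpDl.
  by nra.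
have [A A1 [FA FA']] := cdf_tails tau0.
have [d d0 fd] := uniformly_continuous_itv (- A) A cf eps0.
pose m := (Num.truncn (2 * A / d)).+1.
have m0 : 0 < m%:R :> R by rewrite ltr0n.
pose s := 2 * A / m%:R.
have sd : s < d.
  have H : 2 * A / d < m%:R by exact: truncnS_gt.
  by rewrite /s ltr_pdivrMr// [d * _]mulrC -ltr_pdivrMr.
have s0 : 0 < s by rewrite divr_gt0// mulr_gt0//; lra.
pose x j : R := - A + j%:R * s.
have xS j : x j.+1 = x j + s by rewrite /x -natr1; ring.
have x_incr j : x j < x j.+1 by rewrite xS ltrDl.
have x0 : x 0%N = - A by rewrite /x mul0r addr0.
have xm : x m = A.
  by rewrite /x /s mulrC divfK ?gt_eqF//; ring.
have x_homo i j : (i <= j)%N -> x i <= x j.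
  by move=> ij; rewrite lerD2l ler_wpM2r ?(ltW s0)// ler_nat.
have x_itv j : (j <= m)%N -> - A <= x j <= A.
  by move=> jm; rewrite -{1}x0 -xm !x_homo.
have c_le j : (j < m)%N -> `|f (x j) - f (x j.+1)| <= eps.
  move=> jm; apply/ltW/fd; first by apply: x_itv; exact: ltnW.
  by rewrite xS opprD addrA subrr sub0r normrN gtr0_norm.
have f_osc j t : (j < m)%N -> x j <= t <= x j.+1 -> `|f t - f (x j.+1)| <= eps.
  move=> jm /andP[t1 t2]; rewrite distrC; apply/ltW/fd; first exact: x_itv.
  by rewrite ger0_norm ?subr_ge0// xS; lra.
pose g := interp f x m.
(* [T] is at least 1 outside [[-A, A]], where [g] need not approximate [f], and either state gives
   it at most [F (1 - A) + 1 - F (A - 1)]. *)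
pose T t := ramp (1 - A - 1) (1 - A) t + (1 - ramp (A - 1) A t).
have TC : Cb T.
  have := Cb_lin 1 (Cb_ramp (1 - A - 1) (1 - A))
    (Cb_lin (- 1) (Cb_ramp (A - 1) A) (Cb_cst 1)).
  by congr Cb; apply/funext => t; rewrite /T; ring.
have gC : Cb g by exact: interp_cb.
have fg t : `|f t - g t| <= 4 * B * T t + 2 * eps.
  have /andP[r0 r1] := ramp_itv (1 - A - 1) (1 - A) t.
  have /andP[q0 q1] := ramp_itv (A - 1) A t.
  have T0 : 0 <= T t by rewrite /T; lra.
  have far : 1 <= T t -> `|f t - g t| <= 4 * B * T t + 2 * eps.
    move=> T1; rewrite (le_trans (ler_normB _ _))//.
    have := fB t; have := interp_le x_incr fB m t; rewrite -/g; nra.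
  have [tA|tA] := ltP t (- A).
    by apply: far; rewrite /T ramp1//; lra.
  have [tA'|tA'] := ltP A t.
    by apply: far; rewrite /T (@ramp0 (A - 1) A)//; lra.
  apply: (@le_trans _ _ (2 * eps)); last by rewrite lerDr mulr_ge0// mulr_ge0.
  by apply: interp_close => //; rewrite ?(ltW eps0)// x0 xm tA tA'.
have LT M : cb_state M -> has_cdf M -> M T <= 2 * tau.
  move=> SM MF; have [Mlin _ Mc] := SM.
  have -> : M T = 1 * M (ramp (1 - A - 1) (1 - A)) +
      (- 1 * M (ramp (A - 1) A) + 1).
    rewrite -[X in _ + (_ + X)](Mc 1) -Mlin ?Mc; last 2 first.
    - exact: Cb_ramp.
    - exact: Cb_cst.
    rewrite -Mlin; last 2 first.
    - exact: Cb_ramp.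
    - by apply: Cb_lin; [exact: Cb_ramp|exact: Cb_cst].
    by congr M; apply/funext => t; rewrite /T; ring.
  have := MF (1 - A - 1) (1 - A) ltac:(lra); have := MF (A - 1) A ltac:(lra); lra.
have H1 := cb_state_close SL fC gC TC fg.
have H2 := cb_state_close SL' fC gC TC fg.
have H3 := cb_state_interp SL SL' LF L'F x_incr c_le (ltW eps0).
have [_ Lmono Lc] := SL.
have F1 : F (x m) <= 1.
  have /andP[+ _] := LF (x m) (x m + 1) ltac:(lra); move=> /le_trans; apply.
  rewrite -[leRHS](Lc 1); apply: Lmono => [||t]; [exact: Cb_ramp|exact: Cb_cst|].
  by have /andP[] := ramp_itv (x m) (x m + 1) t.
have F0 : 0 <= F (x 0%N).
  have /andP[_] := LF (x 0%N - 1) (x 0%N) ltac:(lra); apply: le_trans.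
  rewrite -[leLHS](Lc 0); apply: Lmono => [||t]; [exact: Cb_cst|exact: Cb_ramp|].
  by have /andP[] := ramp_itv (x 0%N - 1) (x 0%N) t.
have H4 : eps * (F (x m) - F (x 0%N)) <= eps.
  by rewrite ler_piMr ?(ltW eps0)//; lra.
have B4 : 0 <= 4 * B by rewrite mulr_ge0.
have LT1 := ler_wpM2l B4 (LT _ SL LF); have LT2 := ler_wpM2l B4 (LT _ SL' L'F).
have -> : L f - L' f = (L f - L g) + (L g - L' g) - (L' f - L' g) by ring.
rewrite (le_trans (ler_normB _ _))// (le_trans (lerD (ler_normD _ _) (lexx _)))//.
have E : e = 10 * eps by rewrite /eps; field.
have BE : 4 * B * (2 * tau) = 2^-1 * (16 * B * tau) by field.
move: H1 H2 H3 LT1 LT2; rewrite -/g BE; lra.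
Qed.

End States.
End RampInterpolation.

(** * The method of moments *)

Section MethodOfMoments.
Context {R : realType}.
Local Notation prob := (probability (measurableTypeR R) R).
Implicit Types (nu : prob) (f g h : R -> R).

Lemma integrable_Cb nu f : Cb f -> nu.-integrable setT (EFin \o f).
Proof. by move=> [cf [M fM]]; exact: integrable_cb fM. Qed.

Lemma integral_cb_state nu : cb_state (fun f => \int[nu]_t f t).
Proof.
split.
- move=> c f g fC gC; rewrite RintegralD//; last 2 first.
  + exact/integrable_scale/integrable_Cb.
  + exact: integrable_Cb.
  + by rewrite RintegralZl//; exact: integrable_Cb.
- by move=> f g fC gC fg; apply: le_Rintegral => //; exact: integrable_Cb.
- by move=> c; exact: Rintegral_prob_cst.
Qed.

Lemma integral_has_cdf nu (F : R -> R) :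
  (forall r, nu `]-oo, r]%classic = (F r)%:E) ->
  has_cdf F (fun f => \int[nu]_t f t).
Proof.
move=> nuF a b ab.
have ind r : \int[nu]_t (\1_(`]-oo, r]%classic) t) = F r.
  transitivity (fine (F r)%:E) => //; congr (fine _).
  by rewrite integral_indic// setIT; exact: nuF.
have indi r : nu.-integrable setT (EFin \o (\1_(`]-oo, r]%classic) : R -> R)).
  apply: measurable_bounded_integrable => //.
  - by rewrite -ge0_fin_numE// fin_num_measure.
  - apply: (@bounded_by_fun _ 1) => t.
    by rewrite indicE; case: (_ \in _); rewrite ?normr1 ?normr0.
have ri := integrable_Cb nu (Cb_ramp a b).
rewrite -!ind; apply/andP; split; apply: le_Rintegral => // t _.
  have /andP[r0 _] := ramp_itv a b t.
  rewrite indicE; case: (boolP (t \in _)) => //.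
  by rewrite inE /= in_itv /= => ta; rewrite ramp1.
have /andP[_ r1] := ramp_itv a b t.
rewrite indicE; case: (boolP (t \in _)) => //.
rewrite notin_setE /= in_itv /= => /negP; rewrite -ltNge => bt.
by rewrite ramp0// ltW.
Qed.

Lemma Rintegral_poly_approx C f (e : R) : Cb f -> 0 < e ->
  exists p, forall mu, moment_bound C mu ->
    `|\int[mu]_t f t - \int[mu]_t p.[t]| <= e.
Proof.
move=> fC e0; have [cf [M fM]] := fC.
have [_ _ /(_ _ e0)[p pP]] := poly_L1_approx_cb C cf fM.
exists p => mu muC; rewrite -RintegralB//; last 2 first.
- exact: integrable_Cb.
- exact: (integrable_poly muC p).
apply: le_trans (pP _ muC); apply: le_normr_Rintegral => //.
exact: (integrable_cb_poly muC p cf fM).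
Qed.

Section Limit.
Context (C : R) (mu : nat -> prob).
Hypothesis muC : forall n, moment_bound C (mu n).
Hypothesis moment_cvg : forall k, cvgn (fun n => \int[mu n]_t (t ^+ k) : R).

(** Integrals of a polynomial converge with the moments, and one polynomial approximates [f] for all
    [mu n] at once; its limit [l] is the centre in the Cauchy criterion. *)
Lemma is_cvg_Rintegral_Cb f : Cb f -> cvgn (fun n => \int[mu n]_t f t : R).
Proof.
move=> fC; apply/cauchy_cvgP/cauchy_exP => e e0.
have e2 : 0 < e / 2 by rewrite divr_gt0.
have e4 : 0 < e / 4 by rewrite divr_gt0.
have [p pP] := Rintegral_poly_approx C fC e4.
have pcvg : cvgn (fun n => \int[mu n]_t p.[t] : R).
  under eq_fun do rewrite (Rintegral_poly (muC _)).
  elim: (size p) => [|n IH].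
    by under eq_fun do rewrite big_ord0; exact: is_cvg_cst.
  under eq_fun do rewrite big_ord_recr /=.
  apply: is_cvgD; first exact: IH.
  by apply: is_cvgM; [exact: is_cvg_cst|exact: moment_cvg].
have /cvgrPdist_lt/(_ _ e2) := pcvg; set l := limn _ => lP.
exists l; suff : \forall n \near \oo, `|l - \int[mu n]_t f t| < e by [].
near=> n; have fp := pP _ (muC n).
have ln : `|l - \int[mu n]_t p.[t]| < e / 2 by near: n.
rewrite -(subrKA (\int[mu n]_t p.[t])) (le_lt_trans (ler_normD _ _))//.
by rewrite (distrC (\int[mu n]_t p.[t])); move: ln fp; lra.
Unshelve. all: by end_near. Qed.

(** Meaningful for [f] in [Cb], where the limit exists. *)
Let L f : R := limn (fun n => \int[mu n]_t f t : R).

Let L_lim f : Cb f -> \int[mu n]_t f t @[n --> \oo] --> L f.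
Proof. exact: is_cvg_Rintegral_Cb. Qed.

Let L_state : cb_state L.
Proof.
split.
- move=> c f g fC gC; apply: cvg_lim => //.
  have lin n : \int[mu n]_t (c * f t + g t) =
      c * \int[mu n]_t f t + \int[mu n]_t g t.
    by have [+ _ _] := integral_cb_state (mu n); apply.
  under eq_fun do rewrite lin.
  by apply: cvgD; [apply: cvgM; [exact: cvg_cst|exact: L_lim]|exact: L_lim].
- move=> f g fC gC fg; apply: ler_cvg_to (L_lim fC) (L_lim gC) _.
  apply: nearW => n.
  by have [_ + _] := integral_cb_state (mu n); apply.
- move=> c; apply: cvg_lim => //.
  by under eq_fun do rewrite Rintegral_prob_cst; exact: cvg_cst.
Qed.

Let F (x : R) : R := inf [set L h | h in
  [set h | [/\ Cb h, forall t, 0 <= h t & forall t, t <= x -> 1 <= h t]]].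

Let F_has_inf x : has_inf [set L h | h in
  [set h | [/\ Cb h, forall t, 0 <= h t & forall t, t <= x -> 1 <= h t]]].
Proof.
have [_ Lmono Lc] := L_state; split.
  exists (L (fun=> 1)), (fun=> 1) => //; split => //; exact: Cb_cst.
exists 0 => _ [h [hC h0 _] <-]; rewrite -(Lc 0).
by apply: Lmono => //; exact: Cb_cst.
Qed.

Let F_le x h : Cb h -> (forall t, 0 <= h t) -> (forall t, t <= x -> 1 <= h t) ->
  F x <= L h.
Proof. by move=> hC h0 h1; apply: ge_inf; [exact: (F_has_inf x).2|exists h]. Qed.

Let le_F x (y : R) : (forall h, Cb h -> (forall t, 0 <= h t) ->
  (forall t, t <= x -> 1 <= h t) -> y <= L h) -> y <= F x.
Proof.
move=> yh; apply: lb_le_inf; first exact: (F_has_inf x).1.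
by move=> _ [h [hC h0 h1] <-]; exact: yh.
Qed.

Let F_nd : {homo F : x y / x <= y}.
Proof.
move=> x y xy; apply: le_F => h hC h0 h1; apply: F_le => // t tx.
by rewrite h1// (le_trans tx).
Qed.

Let F_cdf : has_cdf F L.
Proof.
have [_ Lmono Lc] := L_state.
move=> a b ab; apply/andP; split.
  apply: F_le; first exact: Cb_ramp.
    by move=> t; have /andP[] := ramp_itv a b t.
  by move=> t ta; rewrite ramp1.
apply: le_F => h hC h0 h1; apply: Lmono => //; first exact: Cb_ramp.
move=> t; have [tb|/ltW bt] := leP t b; last by rewrite ramp0.
by rewrite (le_trans _ (h1 t tb))//; have /andP[] := ramp_itv a b t.
Qed.

(* If [h >= 1] on [t <= a], then [h + e >= 1] slightly beyond [a]. *)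
Let F_rc : right_continuous F.
Proof.
move=> a; apply/cvgrPdist_lt => e e0.
have e2 : 0 < e / 2 by rewrite divr_gt0.
have [_ [h [hC h0 h1] <-] hF] := inf_adherent e2 (F_has_inf a).
rewrite -/(F a) in hF.
have h2C : Cb (fun t => h t + e / 2).
  have := Cb_lin 1 hC (Cb_cst (e / 2)).
  by congr Cb; apply/funext => t; rewrite mul1r.
have [Llin _ Lc] := L_state.
have Lh2 : L (fun t => h t + e / 2) = L h + e / 2.
  rewrite -[X in _ = X + _]mul1r -[X in _ = _ + X](Lc (e / 2)) -Llin//.
    by congr L; apply/funext => t; rewrite mul1r.
  exact: Cb_cst.
have [ch _] := hC; have /cvgrPdist_lt/(_ _ e2)[d /= d0 hd] := ch a.
near=> x.
have ax : a < x by near: x; exact: nbhs_right_gt.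
have xd : x < a + d by near: x; apply: nbhs_right_lt; rewrite ltrDl.
have Fx : F x <= L h + e / 2.
  rewrite -Lh2; apply: F_le => // [t|t tx]; first by rewrite addr_ge0// ltW.
  have [ta|ta] := leP t a; first by rewrite (le_trans (h1 t ta))// lerDl ltW.
  have : `|h a - h t| < e / 2.
    by apply: hd => /=; rewrite distrC gtr0_norm ?subr_gt0//; lra.
  by have := h1 a (lexx a); rewrite ltr_norml; lra.
have := F_nd (ltW ax); rewrite ltr_distlC; lra.
Unshelve. all: by end_near. Qed.

Let second_moment_le n : \int[mu n]_t (t ^+ 2) <= 2 * `|C|.
Proof.
rewrite (le_trans ((muC n).2 1%N))// expr1 divr1 mulrC.
by rewrite ler_wpM2l// ler_norm.
Qed.

(** The square is unbounded, hence outside the domain of [L]; the comparison is made under each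
    [mu n] and survives the limit. *)
Let L_tail f (a : R) : Cb f -> (forall t, f t <= a * t ^+ 2) -> 0 <= a ->
  L f <= a * (2 * `|C|).
Proof.
move=> fC fa a0; apply: limr_le; first exact: is_cvg_Rintegral_Cb.
apply: nearW => n; rewrite (le_trans _ (ler_wpM2l a0 (second_moment_le n)))//.
rewrite -RintegralZl//; last exact: (muC n).1.
apply: le_Rintegral => //; first exact: integrable_Cb.
exact/integrable_scale/(muC n).1.
Qed.

Let F_tails (e : R) : 0 < e -> exists2 A, 0 < A &
  forall x, A < x -> F (- x) <= e /\ 1 - e <= F x.
Proof.
(* For [x > D] one has [x - 1 >= 1], so [(x - 1) ^+ 2] is at least [x - 1], hence at least
   [2 * |C| / e]: the Chebyshev bound for the tails is then at most [e]. *)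
move=> e0; pose D := 2 * `|C| / e + 2.
have D0 : 2 <= D by rewrite lerDr divr_ge0 ?mulr_ge0// ltW.
have De x : D < x -> (x - 1) ^- 2 * (2 * `|C|) <= e.
  move=> Dx; rewrite mulrC ler_pdivrMr; last by rewrite exprn_gt0//; lra.
  have : 2 * `|C| / e <= x - 1 by rewrite /D in Dx; lra.
  rewrite ler_pdivrMr// => /le_trans; apply; rewrite [leLHS]mulrC.
  by rewrite ler_pM2l// expr2 ler_peMr//; lra.
have F1 x : F x <= 1.
  have [_ _ Lc] := L_state; rewrite -(Lc 1).
  by apply: F_le => //; exact: Cb_cst.
exists D; first by lra.
move=> x Dx; have x1 : 0 < (x - 1) ^+ 2 by rewrite exprn_gt0//; lra.
have big t : x - 1 <= `|t| -> 1 <= (x - 1) ^- 2 * t ^+ 2.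
  move=> xt; rewrite mulrC ler_pdivlMr// mul1r -[leRHS]real_normK ?num_real//.
  by rewrite ler_pXn2r ?nnegrE//; lra.
have nng t : 0 <= (x - 1) ^- 2 * t ^+ 2.
  by rewrite mulr_ge0 ?sqr_ge0// invr_ge0 ltW.
have V0 : 0 <= (x - 1) ^- 2 by rewrite invr_ge0 ltW.
split.
  have /andP[+ _] := F_cdf (a := - x) (b := 1 - x) ltac:(lra).
  move=> /le_trans; apply; apply: le_trans (De x Dx).
  apply: L_tail => //; first exact: Cb_ramp.
  move=> t; have [tx|tx] := leP (1 - x) t; first by rewrite ramp0//; lra.
  have /andP[_ r1] := ramp_itv (- x) (1 - x) t; rewrite (le_trans r1)// big//.
  by rewrite ler_normr; apply/orP; right; lra.
have /andP[_] := F_cdf (a := x - 1) (b := x) ltac:(lra).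
apply: le_trans; have [_ _ Lc] := L_state.
have := cb_state_sub L_state (Cb_cst 1) (Cb_ramp (x - 1) x); rewrite Lc.
suff : L (fun t => 1 - ramp (x - 1) x t) <= e by lra.
apply: le_trans (De x Dx); apply: L_tail => //.
  have := Cb_lin (- 1) (Cb_ramp (x - 1) x) (Cb_cst 1).
  by congr Cb; apply/funext => t; ring.
move=> t; have [tx|tx] := leP t (x - 1); first by rewrite ramp1 ?subrr//; lra.
have /andP[r0 _] := ramp_itv (x - 1) x t.
rewrite (le_trans _ (big t _))//; first by lra.
by rewrite ler_normr; apply/orP; left; lra.
Qed.

Let F_Ny : F x @[x --> -oo%R] --> (0 : R).
Proof.
apply/cvgrPdist_le => e /F_tails[A A0 AF]; near=> x.
have /AF[] : A < - x by rewrite ltrNr; near: x; apply: nbhs_ninfty_lt; rewrite num_real.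
rewrite opprK sub0r normrN => Fe _; rewrite ger0_norm//.
apply: le_F => h hC h0 _; have [_ Lmono Lc] := L_state.
by rewrite -[leLHS](Lc 0); apply: Lmono => //; exact: Cb_cst.
Unshelve. all: by end_near. Qed.

Let F_y : F x @[x --> +oo%R] --> (1 : R).
Proof.
apply/cvgrPdist_le => e /F_tails[A A0 AF]; near=> x.
have /AF[_ Fe] : A < x by near: x; apply: nbhs_pinfty_gt; rewrite num_real.
have F1 : F x <= 1.
  have [_ _ Lc] := L_state; rewrite -(Lc 1).
  by apply: F_le => //; exact: Cb_cst.
by rewrite ger0_norm ?subr_ge0//; lra.
Unshelve. all: by end_near. Qed.

(** The limit functional and integration against the Stieltjes measure of [F] are two states with
    the same distribution function, so they agree on [Cb]. *)
Theorem method_of_moments : exists nu : prob, weak_cvg mu nu.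
Proof.
have [nu nuF] := exists_probability_cdf F_nd F_rc F_Ny F_y.
exists nu => f cf bf; have fC : Cb f by split => //; exact: (bounded_fun_bounded_by bf).
have := L_lim fC.
by rewrite (cb_state_eq F_Ny F_y L_state (integral_cb_state nu) F_cdf
  (integral_has_cdf nuF) fC).
Qed.

End Limit.

Lemma moments_determine C mu nu f : moment_bound C mu -> moment_bound C nu ->
  (forall k, \int[mu]_t (t ^+ k) = \int[nu]_t (t ^+ k)) -> Cb f ->
  \int[mu]_t f t = \int[nu]_t f t.
Proof.
move=> muC nuC E fC.
apply/eqP; rewrite -subr_eq0 -normr_le0; apply/ler_addgt0Pl => e e0; rewrite addr0.
have e2 : 0 < e / 2 by rewrite divr_gt0.
have [p pP] := Rintegral_poly_approx C fC e2.
have pE : \int[mu]_t p.[t] = \int[nu]_t p.[t].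
  rewrite (Rintegral_poly muC) (Rintegral_poly nuC).
  by apply: eq_bigr => i _; rewrite E.
have := pP _ muC; have := pP _ nuC; rewrite pE !ler_norml; lra.
Qed.

End MethodOfMoments.

(** Each of the factors [k + 1, ..., k + m] is at least [k]. For [m = k] this gives
    [k ^ k <= (2k)! / k!], the shape required by [moment_bound]. *)
Lemma expn_fact_le k m : (k`! * k ^ m <= (k + m)`!)%N.
Proof.
elim: m => [|m IH]; first by rewrite expn0 muln1 addn0.
by rewrite addnS factS expnS mulnCA leq_mul// leqW// leq_addr.
Qed.

(** * Moments of the fluctuations and the limit theorem *)

Section FluctuationLaws.
Context {R : realType} {d : nat} {w : 'I_d -> R}.
Context {G : gns w} {A0 : G -> G}.
Hypothesis hA0 : is_A0 A0.
Context {mu : nat -> probability (measurableTypeR R) R}.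
Hypothesis hmu : forall n : nat, (0 < n)%N -> is_law (fluct A0 n) (mu n).

Let c := cumul (star_chi w).
Let c_exch : exchangeable c := cumul_exchangeable (star_chi_exchangeable G).
Let c_single u (a : nat) : count_mem a u = 1%N -> c u = 0.
Proof. exact/cumul_singleton/(star_chi_exchangeable G). Qed.
Let c_le u : `|c u| <= 2 ^+ size u.
Proof. by apply: norm_mixed_le => s; exact: (norm_chi_le1 G). Qed.

Lemma fluct_moments n k : (0 < n)%N ->
  \int[mu n]_t (t ^+ k) = (Num.sqrt n%:R)^-1 ^+ k * wsum c n k [::].
Proof.
by move=> n0; apply: complexI; rewrite (hmu n0).2 (tr_iter_fluct hA0).
Qed.

Lemma fluct_moment_bound n : (0 < n)%N -> moment_bound 72 (mu n).
Proof.
move=> n0; split=> k.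
  (* Integrability comes from the compact support: the complement is negligible, and powers are
     bounded on [K]. *)
  have [[K cK K0] _] := hmu n0.
  have mK : measurable (K : set (measurableTypeR R)) by exact: compact_measurable.
  have mXk : measurable_fun [set: measurableTypeR R] (fun t : R => t ^+ k).
    by apply: continuous_measurable_fun; exact: exprn_continuous.
  apply/(negligible_integrable (measurableC mK) measurableT _ K0).
    exact/measurable_EFinP.
  rewrite setTD setCK; apply: measurable_bounded_integrable => //.
  - by rewrite -ge0_fin_numE// fin_num_measure.
  - have [M [Mr KM]] := compact_bounded cK.
    exists ((`|M| + 1) ^+ k); split; rewrite ?num_real// => y /ltW My t Kt /=.
    rewrite (le_trans _ My)// normrX lerXn2r ?nnegrE ?addr_ge0//.
    by apply: KM => //; rewrite ltr_pwDr// ler_norm.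
rewrite fluct_moments//; have q0 : 0 < Num.sqrt n%:R :> R by rewrite sqrtr_gt0 ltr0n.
have := @wsum_le _ c c_single c_le n k.*2 [::] k.*2 n0 (leqnn _).
rewrite /nsing /= !expr0 !mulr1 => H.
have {}H : (Num.sqrt n%:R)^-1 ^+ k.*2 * wsum c n k.*2 [::] <=
    2 ^+ k.*2 * (3 * Num.sqrt k.*2%:R) ^+ k.*2 :> R.
  rewrite exprVn mulrC ler_pdivrMr ?exprn_gt0//.
  exact: le_trans (ler_norm _) H.
apply: (le_trans H).
rewrite ler_pdivlMr ?ltr0n ?fact_gt0//.
(* Squaring [2 * (3 * sqrt (2k))] gives [4 * 9 * 2k = 72 k], the origin of the constant 72. *)
have -> : 2 ^+ k.*2 * (3 * Num.sqrt k.*2%:R) ^+ k.*2 = (72 ^ k * k ^ k)%:R :> R.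
  have dbl (a : R) : a ^+ k.*2 = (a ^+ 2) ^+ k by rewrite -mul2n exprM.
  rewrite !dbl [(_ * _) ^+ 2]exprMn sqr_sqrtr// -exprMn -mul2n !natrM !natrX -exprMn.
  by congr (_ ^+ k); ring.
rewrite -natrX -!natrM ler_nat -mulnA leq_mul2l [X in _ || (X <= _)%N]mulnC.
by rewrite -addnn expn_fact_le orbT.
Qed.

End FluctuationLaws.

Lemma fluct_moment_cvg {R : realType} {d : nat} {w : 'I_d -> R} {G : gns w}
    {A0 : G -> G} (hA0 : is_A0 A0)
    {mu : nat -> probability (measurableTypeR R) R}
    (hmu : forall n : nat, (0 < n)%N -> is_law (fluct A0 n) (mu n)) k :
  cvgn (fun n => \int[mu n.+1]_t (t ^+ k) : R).
Proof.
have c_exch := cumul_exchangeable (star_chi_exchangeable G).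
have := @is_cvg_wsum R _ c_exch
  (fun u a => @cumul_singleton _ _ u a (star_chi_exchangeable G)) k [::].
move=> /cvg_ex[l]; rewrite -cvg_shiftS => cl; apply/cvg_ex; exists l.
apply: cvg_trans cl; apply: near_eq_cvg; apply: nearW => n.
by rewrite (fluct_moments hA0 hmu)// /nsing /= expr0 mul1r mulrC exprVn.
Qed.

Theorem theorem2p5 (R : realType) (d : nat) (w : 'I_d -> R)
    (hd : (2 <= d)%N)
    (hmono : forall i j : 'I_d, (i <= j)%N -> w j <= w i)
    (hpos : forall i : 'I_d, 0 < w i)
    (hsum : \sum_(i < d) w i = 1) :
  exists mu_w : probability (measurableTypeR R) R,
  forall (G : gns w) (A0 : G -> G) (hA0 : is_A0 A0)
    (mu : nat -> probability (measurableTypeR R) R)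
    (hmu : forall n : nat, (0 < n)%N -> is_law (fluct A0 n) (mu n)),
  weak_cvg mu mu_w.
Proof.
(* The limit must be fixed before [G], so it is built from one chosen instance; if there is none,
   the claim is vacuous and a Dirac mass serves as default. *)
have [[G0 [B0 [hB0 [mu0 hmu0]]]]|none] := pselect (exists (G : gns w) (A0 : G -> G),
    is_A0 A0 /\ exists mu : nat -> probability (measurableTypeR R) R,
    forall n : nat, (0 < n)%N -> is_law (fluct A0 n) (mu n)); last first.
  exists (\d_(0 : measurableTypeR R) : probability (measurableTypeR R) R) => G A0 hA0 mu hmu; exfalso; apply: none.
  by exists G, A0; split => //; exists mu.
have [nu nuP] := method_of_moments
  (fun n => fluct_moment_bound hB0 hmu0 (ltn0Sn n)) (fluct_moment_cvg hB0 hmu0).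
(* The shift of the index discards [n = 0], for which [mu] is not constrained. *)
exists nu => G A0 hA0 mu hmu f cf bf; rewrite -cvg_shiftS.
have fC : Cb f by split => //; exact: (bounded_fun_bounded_by bf).
apply: cvg_trans (nuP f cf bf); apply: near_eq_cvg; apply: nearW => n /=.
(* The moments are expressed by [chi w] alone, so they agree for the two instances, and by
   determinacy so do the integrals of [f]. *)
apply: (moments_determine (fluct_moment_bound hB0 hmu0 _)
  (fluct_moment_bound hA0 hmu _)) => // k.
by rewrite (fluct_moments hB0 hmu0)// (fluct_moments hA0 hmu).
Qed.
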